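(* For any sequence $(r_i)_{i\ge1}$ of rationals in $\mathbb Q\cap(0,1)$ there exists a unique $\beta\in\bigcap_{n=1}^\infty I_{r_1,r_2,\ldots,r_n}$ satisfying $$\delta(\beta)=\lim_{n\to\infty}\mathbb L(\mathbf w_{r_1}\bullet\mathbf w_{r_2}\bullet\cdots\bullet\mathbf w_{r_n})^\infty .$$ Moreover, if $r_i=\frac{p_i}{q_i}$ with $\gcd(p_i,q_i)=1$ for all $i\in\mathbb N$, then for any $n\in\mathbb N$ and $m=\prod_{i=1}^nq_i$ we have $$\tau_m(\beta)=\big((\mathbf w_{r_1}\bullet\mathbf w_{r_2}\bullet\cdots\bullet\mathbf w_{r_n})^\infty\big)_\beta.$$
   Context: Critical value. For $\beta\in(1,2]$ let $T_\beta:[0,1)\to[0,1)$, $x\mapsto\beta x\pmod1$, and for $t\in[0,1)$ let $K_\beta(t)=\{x\in[0,1):T_\beta^n(x)\notin(0,t)\ \forall n\ge0\}$. For an integer $m\ge2$, $\tau_m(\beta)=\sup\{t\in[0,1):K_\beta(t)\text{ contains a periodic orbit of smallest period }m\}$ (under $T_\beta$), with $\sup\emptyset=0$. Expansions. For $(d_i)\in\{0,1\}^{\mathbb N}$, $((d_i))_\beta=\sum_{i\ge1}d_i\beta^{-i}$; $(d_i)$ is a $\beta$-expansion of this number. $\delta(\beta)\in\{0,1\}^{\mathbb N}$ is the quasi-greedy $\beta$-expansion of $1$, i.e. the lexicographically largest $\beta$-expansion of $1$ not ending with $0^\infty$. Limits of sequences are in the product topology on $\{0,1\}^{\mathbb N}$.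 Words. $\{0,1\}^*$ is the set of finite words over $\{0,1\}$. For a word $\mathbf w$, $\mathbf w^\infty=\mathbf w\mathbf w\cdots$, and $\mathbb L(\mathbf w)$ is the lexicographically largest cyclic permutation of $\mathbf w$. If $\mathbf w$ ends with $0$, $\mathbf w^+$ is $\mathbf w$ with last digit changed to $1$; if $\mathbf w$ ends with $1$, $\mathbf w^-$ is $\mathbf w$ with last digit changed to $0$. Farey words. For a rational $p/q\in(0,1)$ with $\gcd(p,q)=1$, let $R_{p/q}:\mathbb R/\mathbb Z\to\mathbb R/\mathbb Z$, $x\mapsto x+p/q\pmod1$. The Farey word $\mathbf w_{p/q}=w_1\ldots w_q$ is given by $w_k=1$ if $0\in(R_{p/q}^{k-1}(0),R_{p/q}^k(0)]$ (arc of the circle), and $w_k=0$ otherwise; equivalently $w_k=\lfloor kp/q\rfloor-\lfloor (k-1)p/q\rfloor$. If $\gcd(p,q)=d>1$, $\mathbf w_{p/q}:=\mathbf w_{(p/d)/(q/d)}$. Lyndon words and substitution. A word is a Lyndon word if it is not a proper power of a shorter word and is the lexicographically smallest of its cyclic permutations; Farey words of length at least two are Lyndon words. For a Lyndon word $\mathbf s$ of length at least two (it begins with $0$ and ends with $1$) and $\mathbf r=r_1\ldots r_n\in\{0,1\}^*$, define $\mathbf s\bullet\mathbf r=\mathbf w_1\ldots\mathbf w_n$, where $\mathbf w_1=\mathbf s^-$ if $r_1=0$, $\mathbf w_1=\mathbb L(\mathbf s)^+$ if $r_1=1$, and for $1\le k<n$, $\mathbf w_{k+1}$ equals $\mathbb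 L(\mathbf s)$, $\mathbb L(\mathbf s)^+$, $\mathbf s^-$, $\mathbf s$ according as $r_kr_{k+1}=00,01,10,11$. The operation $\bullet$ is associative on Lyndon words of length at least two. Partition intervals. For $m\ge2$, an admissible $m$-chain is a vector $(m,k_1,\ldots,k_\ell)$ of positive integers with $k_i<m_i:=\gcd(m,k_1,\ldots,k_{i-1})$ for all $1\le i\le\ell$ (where $m_1=m$) and $\gcd(m,k_1,\ldots,k_\ell)=1$; $\mathcal A_m$ is the set of these, totally ordered lexicographically, with largest element $(m,m-1)$. For $(m,k_1,\ldots,k_j)\in\mathcal A_m$, $\beta_{m,k_1,\ldots,k_j}$ is the largest $\beta\in(1,2)$ with $(\mathbb L(\mathbf w_{k_1/m_1}\bullet\cdots\bullet\mathbf w_{k_j/m_j})^\infty)_\beta=1$. If $(m,k_1,\ldots,k_j)\ne(m,m-1)$, then $I_{m,k_1,\ldots,k_j}=(\beta_{m,k_1,\ldots,k_j},\beta_{m,k_1',\ldots,k_l'}]$, where $(m,k_1',\ldots,k_l')$ is the immediate successor of $(m,k_1,\ldots,k_j)$ in $\mathcal A_m$; and $I_{m,m-1}=(\beta_{m,m-1},2]$. For rationals $r_i=p_i/q_i\in(0,1)$ in lowest terms, $1\le i\le n$, put $Q_i=\prod_{k=i}^nq_k$ and $P_i=p_i\prod_{k=i+1}^nq_k$. Then $(Q_1,P_1,\ldots,P_n)$ is an admissible $Q_1$-chain with $Q_i=\gcd(Q_1,P_1,\ldots,P_{i-1})$ and $P_i/Q_i=r_i$, and $I_{r_1,\ldots,r_n}:=I_{Q_1,P_1,\ldots,P_n}$.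 *)

(* Defs.v *)
From HB Require Import structures.
From mathcomp Require Import all_boot all_order all_algebra.
From mathcomp Require Import all_classical all_reals all_analysis.

Set Implicit Arguments.
Unset Strict Implicit.
Unset Printing Implicit Defensive.
Import Order.TTheory GRing.Theory Num.Theory.
Import numFieldNormedType.Exports.
Local Open Scope classical_set_scope.
Local Open Scope ring_scope.

(* The digits 0 and 1 are [false] and [true].  Infinite digit sequences are
   points of [cantor_space] (nat -> bool with the product topology).  All
   sequences are indexed from 0: the digit d_i is [d i.-1]. *)

Definition largest (T : pointedType) (le : T -> T -> Prop) (A : set T) : T :=
  xget point [set x | A x /\ forall y, A y -> le y x].

Definition expansion_value (R : realType) (d : cantor_space) (beta : R) : R :=
  limn (series (fun i : nat => (d i)%:R / beta ^+ i.+1)).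

Definition lexle (d e : cantor_space) : Prop :=
  d = e \/
  exists n, [/\ forall i, (i < n)%N -> d i = e i, d n = false & e n = true].

Definition ends_with_zeros (d : cantor_space) : Prop :=
  exists N, forall i, (N <= i)%N -> d i = false.

Definition quasi_greedy (R : realType) (beta : R) : cantor_space :=
  largest lexle [set d | expansion_value d beta = 1 /\ ~ ends_with_zeros d].

Definition Tbeta (R : realType) (beta x : R) : R :=
  beta * x - (Num.floor (beta * x))%:~R.

Definition survivor (R : realType) (beta t : R) : set R :=
  [set x | 0 <= x < 1 /\ forall n, ~ (0 < iter n (Tbeta beta) x < t)].

Definition smallest_period (R : realType) (beta : R) (m : nat) (x : R) : Prop :=
  [/\ (0 < m)%N, iter m (Tbeta beta) x = x &
      forall k, (0 < k < m)%N -> iter k (Tbeta beta) x <> x].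

(* [sup set0 = 0] *)
Definition tau (R : realType) (m : nat) (beta : R) : R :=
  sup [set t : R | 0 <= t < 1 /\
    exists x : R, smallest_period beta m x /\
      forall n, survivor beta t (iter n (Tbeta beta) x)].

Definition word := seq bool.

Definition winfty (w : word) : cantor_space :=
  fun i => nth false w (i %% size w).

Definition Lmax (w : word) : word :=
  \big[Order.max/([::] : seqlexi bool)]_(k < size w) (rot k w : seqlexi bool).

Definition wplus (w : word) : word := set_nth false w (size w).-1 true.
Definition wminus (w : word) : word := set_nth false w (size w).-1 false.

(* Rationals of type [rat] are always in lowest terms, so [farey (p / q)] is
   automatically the word of the reduced fraction. *)
Definition numn (r : rat) : nat := `|numq r|%N.
Definition denn (r : rat) : nat := `|denq r|%N.

(* The digit w_k = floor(k p/q) - floor((k-1) p/q) is 1 exactly when the arc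
   from (k-1) p/q (excluded) to k p/q (included) of R/Z contains 0. *)
Definition farey (r : rat) : word :=
  mkseq (fun k => (k.+1 * numn r) %/ denn r - (k * numn r) %/ denn r == 1)%N
        (denn r).

Definition bullet_block (s : word) (a b : bool) : word :=
  match a, b with
  | false, false => Lmax s
  | false, true => wplus (Lmax s)
  | true, false => wminus s
  | true, true => s
  end.

Definition bullet (s r : word) : word :=
  if r is r1 :: r' then
    flatten ((if r1 then wplus (Lmax s) else wminus s)
               :: pairmap (bullet_block s) r1 r')
  else [::].

(* w_1 . w_2 . ... . w_n, bracketed to the left; junk on the empty list *)
Definition bullets (ws : seq word) : word :=
  if ws is w :: ws' then foldl bullet w ws' else [::].

Definition farey_bullets (rs : seq rat) : word :=
  bullets [seq farey r | r <- rs].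

(* The chain (m, k_1, ..., k_l) is represented by [m] and
   [ks = [:: k_1; ...; k_l]]; [chain_gcd m ks i] is m_{i+1} = gcd(m, k_1, ..., k_i). *)
Definition chain_gcd (m : nat) (ks : seq nat) (i : nat) : nat :=
  foldl gcdn m (take i ks).

Definition admissible (m : nat) (ks : seq nat) : Prop :=
  [/\ (2 <= m)%N,
      forall i, (i < size ks)%N -> (0 < nth 0%N ks i < chain_gcd m ks i)%N &
      chain_gcd m ks (size ks) = 1%N].

Definition chain_lt (ks ls : seqlexi nat) : bool := (ks < ls)%O.

Definition immediate_succ (m : nat) (ks ks' : seq nat) : Prop :=
  [/\ admissible m ks',
      chain_lt ks ks' &
      forall ls, admissible m ls ->
        ~ (chain_lt ks ls /\ chain_lt ls ks')].

Definition chain_word (m : nat) (ks : seq nat) : word :=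
  farey_bullets
    (mkseq (fun i => (nth 0%N ks i)%:R / (chain_gcd m ks i)%:R) (size ks)).

Definition beta_chain (R : realType) (m : nat) (ks : seq nat) : R :=
  largest (fun x y : R => x <= y)
    [set b : R | 1 < b < 2 /\
       expansion_value (winfty (Lmax (chain_word m ks))) b = 1].

Definition I_chain (R : realType) (m : nat) (ks : seq nat) : set R :=
  [set b : R | beta_chain R m ks < b /\
     if ks == [:: m.-1] then (b <= 2 : Prop)
     else exists2 ks', immediate_succ m ks ks' & b <= beta_chain R m ks'].

Arguments I_chain : clear implicits.

(* I_{r_1, ..., r_n} = I_{Q_1, P_1, ..., P_n} *)
Definition I_rat (R : realType) (rs : seq rat) : set R :=
  I_chain R (\prod_(r <- rs) denn r)%N
    (mkseq (fun i => numn (nth 0%R rs i) * \prod_(r <- drop i.+1 rs) denn r)%N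
           (size rs)).
Arguments I_rat : clear implicits.

(* Main.v *)
Require Import Defs.
From mathcomp Require Import all_boot all_order all_algebra.
From mathcomp Require Import all_classical all_reals all_analysis.
From mathcomp Require Import zify ring lra.
Import Order.TTheory GRing.Theory Num.Theory.
Import numFieldNormedType.Exports.

(** For a rational slope r = p/q the Farey word is 0v1 and its largest rotation
is 1v0, with the same v.  Let theta_r be the substitution 0 -> v01, 1 -> v10.
The blocks of w_r • x are, up to a shift by one digit, the images under theta_r
of the digits of x.  Hence the infinite repetition of w_(r_1) • ... • w_(r_n) is
obtained from 111... by applying successively d |-> 0 theta_(r_i)(d), and the
repetition of its largest rotation is obtained from 000... by applying
d |-> 1 theta_(r_i)(d); these two sequences are called [low] and [high].  The
operation d |-> c theta_r(d) is [farey_subst], and [farey_substs_blocks] is the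
associativity that relates this right nested description to the left nested
product of words.  The sequences [high] converge to a sequence [delta] that is
a fixed point of the construction: delta(r_1, r_2, ...) is
1 theta_(r_1)(delta(r_2, r_3, ...)).

All combinatorial facts come from one computation: the number of ones among
the first k digits of c theta_(p/q)(d) is c + floor(k p/q), up to a correction
by one when q divides k ([psum_farey_subst]).  Comparing these counting
functions gives lexicographic comparisons ([psum_lexle]): every shift of [low]
lies between [low] and [high], [delta] is at least as large as all its shifts,
and two substitutions of different slopes have separated images
([farey_subst_slope_lt]), so that [high] increases with the chain.

The critical value asks for the largest sequence s, minimal among its shifts,
of smallest period m = q_1 ... q_n, all of whose shifts are below delta.  This is
[low] by [low_extremal].  If all shifts of e lie between 0 theta_r(000...) and
1 theta_r(111...), then the number of ones in each window of length k differs
from k p/q by at most one; starting at a place where the discrepancy is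
maximal, e reads 0 theta_r(g) for some g ([desubstitute]), and g satisfies the
same hypotheses with one slope less.

The rest is the classical theory of expansions.  If d is at least as large as
all its shifts, has infinitely many ones, and has value 1 in base b, then d is
the quasi-greedy expansion of 1 in base b, and sequences whose shifts are all
below d are exactly the itineraries of the points of [0, 1) under T_b.  The base
is a strictly increasing function of d ([base_lt]), which turns the comparisons of
[delta] with the sequences [high] into the membership in the intervals I. *)

Set Implicit Arguments.
Unset Strict Implicit.
Unset Printing Implicit Defensive.

(** * The lexicographic order on digit sequences *)

Section Lexicographic.
Local Open Scope nat_scope.

Definition lexlt (x y : nat -> bool) : Prop :=
  exists n, [/\ forall i, i < n -> x i = y i, x n = false & y n = true].

Definition shiftn (k : nat) (x : nat -> bool) : nat -> bool := fun i => x (k + i).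

Lemma shift0 x : shiftn 0 x = x.
Proof. by []. Qed.

Lemma shift_shift j k x : shiftn j (shiftn k x) = shiftn (k + j) x.
Proof. by apply/funext => i; rewrite /shiftn addnA. Qed.

Lemma lexltP x y : lexlt x y \/ x = y \/ lexlt y x.
Proof.
have [[n ne]|eq] := pselect (exists n, x n != y n); last first.
  right; left; apply/funext => n; apply/eqP/negPn/negP => ne; apply: eq.
  by exists n.
have ex : exists n, x n != y n by exists n.
case: (ex_minnP ex) => k nek mink.
have eqk i : i < k -> x i = y i.
  by move=> ik; apply/eqP/negPn/negP => /mink; rewrite leqNgt ik.
case xk : (x k) nek; case yk : (y k) => // _.
- right; right; exists k; split => // i ik; by rewrite eqk.
- by left; exists k.
Qed.

Lemma lexlt_irr x : ~ lexlt x x.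
Proof. by case=> n [_ -> ]. Qed.

Lemma lexlt_trans y x z : lexlt x y -> lexlt y z -> lexlt x z.
Proof.
move=> [n [xy xn yn]] [k [yz yk zk]].
case: (ltngtP n k) => [nk|kn|e].
- exists n; split=> [i ni| |]; [|by []|]; last by rewrite -yz.
  by rewrite xy // yz // (ltn_trans ni).
- exists k; split=> [i ni| |]; [|by rewrite xy|by []].
  by rewrite xy ?yz // (ltn_trans ni).
- by move: yk; rewrite -e yn.
Qed.

Lemma lexle_refl x : lexle x x.
Proof. by left. Qed.

Lemma lexltW x y : lexlt x y -> lexle x y.
Proof. by right. Qed.

Lemma lexle_trans y x z : lexle x y -> lexle y z -> lexle x z.
Proof.
move=> [->//|xy] [<-|yz]; right=> //; exact: (@lexlt_trans y).
Qed.

Lemma lexle_lt_trans y x z : lexle x y -> lexlt y z -> lexlt x z.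
Proof. move=> [->//|xy] yz; exact: (@lexlt_trans y). Qed.

Lemma lexlt_le_trans y x z : lexlt x y -> lexle y z -> lexlt x z.
Proof. move=> xy [<-//|yz]; exact: (@lexlt_trans y). Qed.

Lemma lexleNgt x y : lexle x y <-> ~ lexlt y x.
Proof.
split=> [xy yx|]; first by exact: lexlt_irr (lexle_lt_trans xy yx).
by have [|[->|]] := lexltP x y => // *; [right|left].
Qed.

Lemma lexle_anti x y : lexle x y -> lexle y x -> x = y.
Proof. by move=> [//|xy] /lexleNgt. Qed.

Lemma lexle_true x : lexle x (fun=> true).
Proof. by apply/lexleNgt => -[n []]. Qed.

Lemma lexle_false x : lexle (fun=> false) x.
Proof. by apply/lexleNgt => -[n []]. Qed.

(** Putting a 1 in front of a sequence can only increase it: the two agree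
along the initial run of ones. *)
Lemma lexle_shift_true k x : x k = true -> lexle (shiftn k.+1 x) (shiftn k x).
Proof.
move=> xk; apply/lexleNgt => -[n [eqn]].
have : forall i, i <= n -> shiftn k x i = true.
  elim=> [|i IH] lin; first by rewrite /shiftn addn0.
  have := eqn i lin; rewrite IH; last exact: ltnW.
  by rewrite /shiftn addSnnS => <-.
by move=> -> .
Qed.

Lemma lexle_shift_false k x : x k = false -> lexle (shiftn k x) (shiftn k.+1 x).
Proof.
move=> xk; apply/lexleNgt => -[n [eqn e1 e2]].
have : forall i, i <= n -> shiftn k x i = false.
  elim=> [|i IH] lin; first by rewrite /shiftn addn0.
  have := eqn i lin; rewrite IH; last exact: ltnW.
  by rewrite /shiftn addSnnS => ->.
by move/(_ n (leqnn n)); rewrite e2.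
Qed.

Definition psum (x : nat -> bool) k : nat := \sum_(i < k) x i.

Lemma psum0 x : psum x 0 = 0.
Proof. by rewrite /psum big_ord0. Qed.

Lemma psumS x k : psum x k.+1 = psum x k + x k.
Proof. by rewrite /psum big_ord_recr. Qed.

Lemma psumD x j k : psum x (j + k) = psum x j + psum (shiftn j x) k.
Proof.
elim: k => [|k IH]; first by rewrite psum0 !addn0.
by rewrite addnS !psumS IH addnA.
Qed.

Lemma psum_eq x y k : (forall i, i < k -> x i = y i) -> psum x k = psum y k.
Proof. by move=> h; apply: eq_bigr => i _; rewrite h. Qed.

Lemma psum_inj x y : (forall k, psum x k = psum y k) -> x = y.
Proof.
move=> h; apply/funext => k; have := h k.+1; rewrite !psumS h.
by case: (x k); case: (y k) => //; lia.
Qed.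

(** At the first difference of x and y the counts differ by exactly one, in the
direction of the order. *)
Lemma psum_lexle x y : (forall k, psum x k <= psum y k) -> lexle x y.
Proof.
move=> h; apply/lexleNgt => -[n [eqn yn xn]].
have := h n.+1; rewrite !psumS xn yn (psum_eq eqn); lia.
Qed.

End Lexicographic.

(** * The substitution attached to a slope *)

Section Substitution.
Local Open Scope nat_scope.

(** The digit number k + 1 of the Farey word of slope p/q, repeated. *)
Definition mech p q k : bool := (k.+1 * p) %/ q - (k * p) %/ q == 1.

(** The sequence c theta(x), where theta(0) = v01, theta(1) = v10 and 0v1 is the
Farey word of slope p/q.  The block of q digits number i of this sequence is
(1 - x_(i-1)) v x_i, with x_(-1) = 1 - c. *)
Definition farey_subst p q c (x : nat -> bool) : nat -> bool := fun k =>
  if q %| k.+1 then x (k %/ q)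
  else if q %| k then (if k is 0 then c else ~~ x (k %/ q).-1)
  else mech p q k.

Section Subst.
Variables (p q : nat).
Hypothesis p0 : 0 < p.
Hypothesis pq : p < q.

Let q0 : 0 < q. Proof. lia. Qed.
Let q1 : 1 < q. Proof. lia. Qed.

Lemma mechE k : (k * p) %/ q + mech p q k = (k.+1 * p) %/ q.
Proof.
have h1 : (k * p) %/ q <= (k.+1 * p) %/ q by apply: leq_div2r; nia.
have h2 : (k.+1 * p) %/ q <= ((k * p) %/ q).+1.
  rewrite -ltnS ltn_divLR // mulSn.
  have := ltn_ceil (k * p) q0; nia.
rewrite /mech; case: eqP => /=; lia.
Qed.

Lemma mech_dvd k : q %| k -> mech p q k = false.
Proof.
move=> /dvdnP[j ->]; have := mechE (j * q).
have -> : (j * q) * p = j * p * q by lia.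
have -> : (j * q).+1 * p = (j * p) * q + p by lia.
rewrite mulnK // divnMDl // (divn_small pq).
by case: mech => //; lia.
Qed.

Lemma mech_dvdS k : q %| k.+1 -> mech p q k = true.
Proof.
move=> /dvdnP[j jk]; have := mechE k.
rewrite jk.
have -> : j * q * p = j * p * q by lia.
rewrite mulnK //.
have : (k * p) %/ q < j * p by rewrite ltn_divLR //; nia.
case: mech => //; lia.
Qed.

Lemma mech_add k j : mech p q (j * q + k) = mech p q k.
Proof.
have := mechE k; have := mechE (j * q + k).
have -> : (j * q + k) * p = j * p * q + k * p by lia.
have -> : (j * q + k).+1 * p = j * p * q + k.+1 * p by lia.
rewrite !divnMDl //; case: mech; case: mech => //=; lia.
Qed.

Lemma ndvdS k : q %| k -> (q %| k.+1) = false.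
Proof.
move=> qk; apply/negP => qk1; have : q %| k.+1 - k by exact: dvdn_sub.
by rewrite subSnn dvdn1; lia.
Qed.

Lemma farey_subst_last c x i : farey_subst p q c x (i * q + q.-1) = x i.
Proof.
rewrite /farey_subst; have -> : (i * q + q.-1).+1 = i.+1 * q by lia.
by rewrite dvdn_mull // divnMDl // divn_small ?addn0 //; lia.
Qed.

Lemma farey_subst_first c x i : farey_subst p q c x (i.+1 * q) = ~~ x i.
Proof.
rewrite /farey_subst ndvdS ?dvdn_mull // mulnK //.
by case e : (i.+1 * q) => [|n] //; lia.
Qed.

Lemma farey_subst_0 c x : farey_subst p q c x 0 = c.
Proof. by rewrite /farey_subst ndvdS ?dvdn0. Qed.

Lemma farey_subst_mid c x k : ~~ (q %| k.+1) -> ~~ (q %| k) -> farey_subst p q c x k = mech p q k.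
Proof. by rewrite /farey_subst => /negbTE-> /negbTE->. Qed.

Lemma divS_dvd k : q %| k.+1 -> (k.+1 %/ q).-1 = k %/ q.
Proof.
case/dvdnP => -[//|i] ki; rewrite ki mulnK //.
have -> : k = i * q + q.-1 by lia.
rewrite divnMDl // divn_small; lia.
Qed.

(** The two digits x_i and 1 - x_i around each multiple of q contribute exactly
one 1, so x only influences the counts at the multiples of q themselves. *)
Lemma psum_farey_subst c x k : 0 < k ->
  psum (farey_subst p q c x) k + (q %| k) = c + k * p %/ q + (q %| k) * x (k %/ q).-1.
Proof.
elim: k => // -[_ _|k IH _].
  rewrite psumS psum0 farey_subst_0 mul1n (divn_small pq).
  by rewrite dvdn1 (_ : (q == 1) = false); lia.
have {}IH := IH isT; rewrite psumS -mechE; set K := k.+1 in IH *.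
have K0 : 0 < K by []; move: IH.
rewrite [farey_subst p q c x K]/farey_subst; case: ifP => qK1.
  have qK : (q %| K) = false by apply: contraTF qK1 => /ndvdS->.
  rewrite qK mech_dvdS //.
  rewrite divS_dvd //; move: (x _) (K * p %/ q) (psum _ _) => b u w.
  by case: b => /= {qK1 qK K0}; lia.
case: ifP => qK; last first.
  by rewrite !mul0n; move: (K * p %/ q) (psum _ _) => u w {qK1 qK K0}; lia.
by rewrite /K -/K mech_dvd //; case: (x _) => /=; lia.
Qed.

Lemma psum_farey_subst_ndvd c x k : ~~ (q %| k) ->
  psum (farey_subst p q c x) k = c + k * p %/ q.
Proof.
move=> qk; have k0 : 0 < k by case: k qk => //; rewrite dvdn0.
by have := psum_farey_subst c x k0; rewrite (negbTE qk); lia.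
Qed.

Lemma psum_farey_subst_dvd c x k :
  psum (farey_subst p q c x) (k.+1 * q) + 1 = c + k.+1 * p + x k.
Proof.
have := @psum_farey_subst c x (k.+1 * q); rewrite dvdn_mull // mulnK //=.
have -> : k.+1 * q * p = k.+1 * p * q by lia.
by rewrite mulnK // mul1n => ->//; lia.
Qed.

Lemma shift_farey_subst c x i :
  shiftn (i.+1 * q) (farey_subst p q c x) = farey_subst p q (~~ x i) (shiftn i.+1 x).
Proof.
apply/funext => k; rewrite /shiftn.
rewrite /farey_subst -addnS !dvdn_addr ?dvdn_mull //.
rewrite divnMDl //; case: ifP => // qk1.
case: ifP => [qk|_]; last by rewrite mech_add.
case: k {qk1} qk => [|k] qk.
  rewrite addn0 div0n addn0 /=.
  by case e : (_ * _) => [|//]; lia.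
have kq : 0 < k.+1 %/ q by rewrite divn_gt0 // dvdn_leq.
case e : (_ * _ + _) => [|n]; first by lia.
rewrite /=; congr (~~ x _); lia.
Qed.

Lemma lexlt_farey_subst c x y : lexlt x y -> lexlt (farey_subst p q c x) (farey_subst p q c y).
Proof.
move=> [n [eqn xn yn]]; exists (n * q + q.-1).
rewrite !farey_subst_last; split => // i ik; rewrite /farey_subst.
case: ifP => [qi1|_].
  rewrite eqn // ltn_divLR //.
  case/dvdnP: qi1 => j ji; have : j * q < n.+1 * q by lia.
  by rewrite ltn_pmul2r // ltnS => jn; rewrite ji leq_mul2r jn orbT.
case: ifP => [qi|//]; case: i ik qi => // i ik qi.
rewrite eqn //; case/dvdnP: qi => j ji; rewrite ji mulnK //.
have : j * q < n.+1 * q by lia.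
rewrite ltn_pmul2r // ltnS; case: j ji => //; lia.
Qed.

Lemma lexle_farey_subst c x y : lexle x y -> lexle (farey_subst p q c x) (farey_subst p q c y).
Proof. by move=> [->|/(lexlt_farey_subst c)]; [left|right]. Qed.

Lemma lexlt_farey_substE c x y : lexlt (farey_subst p q c x) (farey_subst p q c y) -> lexlt x y.
Proof.
have [//|[->|yx]] := lexltP x y; first by move/lexlt_irr.
by move=> h; case: (lexlt_irr (lexlt_trans h (lexlt_farey_subst c yx))).
Qed.

Lemma lexlt_farey_subst01 x y : lexlt (farey_subst p q false x) (farey_subst p q true y).
Proof. by exists 0; rewrite !farey_subst_0. Qed.

Lemma lexle_farey_subst_digit c x y : lexle x y -> lexle (farey_subst p q c x) (farey_subst p q true y).
Proof. case: c; first exact: lexle_farey_subst. by move=> _; right; apply: lexlt_farey_subst01. Qed.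

Lemma leq_divD a b : a %/ q + b %/ q <= (a + b) %/ q.
Proof. by rewrite divnD // leq_addr. Qed.

(** A window starting inside a block has a count of the form
floor((j + k) p/q) - floor(j p/q), which is at most 1 + floor(k p/q); no shift
beginning inside a block can exceed a sequence 1 theta(y). *)
Lemma shift_farey_subst_le c x y j : ~~ (q %| j) ->
  lexle (shiftn j (farey_subst p q c x)) (farey_subst p q true y).
Proof.
move=> qj; apply: psum_lexle => -[|k]; first by rewrite !psum0.
have := psumD (farey_subst p q c x) j k.+1.
rewrite (psum_farey_subst_ndvd c x qj) => e.
have jk0 : 0 < j + k.+1 by rewrite addnS.
have := psum_farey_subst c x jk0; have := psum_farey_subst true y (ltn0Sn k).
rewrite e mulnDl; case: (boolP (q %| k.+1)) => qk.
  rewrite dvdn_addl // (negbTE qj) divnDr ?dvdn_mulr // {qj qk e jk0}.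
  move: (j * p %/ q) (k.+1 * p %/ q) => a b.
  by case: (y _) => /=; rewrite ?mul0n; lia.
have := leq_divDl q (j * p) (k.+1 * p) => {qj qk e jk0}.
move: (j * p %/ q) (k.+1 * p %/ q) ((j * p + k.+1 * p) %/ q) => a b d.
by case: (q %| j + k.+1); case: (x _) => /=; rewrite ?mul0n; lia.
Qed.

Hypothesis pqC : coprime p q.

Lemma shift_farey_subst_ge c x y j : ~~ (q %| j) ->
  lexle (farey_subst p q false y) (shiftn j (farey_subst p q c x)).
Proof.
move=> qj; apply: psum_lexle => -[|k]; first by rewrite !psum0.
have := psumD (farey_subst p q c x) j k.+1.
rewrite (psum_farey_subst_ndvd c x qj) => e.
have jk0 : 0 < j + k.+1 by rewrite addnS.
have := psum_farey_subst c x jk0; have := psum_farey_subst false y (ltn0Sn k).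
rewrite e mulnDl; case: (boolP (q %| k.+1)) => qk.
  rewrite dvdn_addl // (negbTE qj) divnDr ?dvdn_mulr // {qj qk e jk0}.
  move: (j * p %/ q) (k.+1 * p %/ q) => a b.
  by case: (y _) => /=; rewrite ?mul0n; lia.
case: (boolP (q %| j + k.+1)) => qjk; last first.
  have := leq_divD (j * p) (k.+1 * p) => {qj qk qjk e jk0}.
  move: (j * p %/ q) (k.+1 * p %/ q) ((j * p + k.+1 * p) %/ q) => a b d.
  by rewrite !mul0n; lia.
have qjp : ~~ (q %| j * p) by rewrite Gauss_dvdl // coprime_sym.
have : q %| j * p + k.+1 * p by rewrite -mulnDl dvdn_mulr.
move=> /dvdnP[N eN]; rewrite eN mulnK //.
have := divn_eq (j * p) q; have : 0 < (j * p) %% q by rewrite lt0n.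
move=> v0 ev; have : k.+1 * p %/ q < N - j * p %/ q.
  rewrite ltn_divLR // mulnBl; move: v0 eN; rewrite {1 2}ev.
  by move: (_ %/ _) (_ %% _) => a v; lia.
move=> {qj qk qjk e jk0 qjp eN v0 ev}.
move: (j * p %/ q) (k.+1 * p %/ q) => a b.
by rewrite mul0n mul1n; case: (x _) => /=; lia.
Qed.

Lemma psum_farey_subst_true k : psum (farey_subst p q false (fun=> true)) k = k * p %/ q.
Proof.
case: k => [|k]; first by rewrite psum0 div0n.
have := psum_farey_subst false (fun=> true) (ltn0Sn k); lia.
Qed.

(** The start j is chosen with j p = -1 modulo q: from there the counting
function is the ceiling of k p/q instead of its floor. *)
Lemma shift_christoffel :
  exists j, shiftn j (farey_subst p q false (fun=> true)) = farey_subst p q true (fun=> false).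
Proof.
have [a _] := Bezoutl p q0; rewrite (eqnP (_ : coprime q p)); last by rewrite coprime_sym.
case/dvdnP => t et; exists a; apply: psum_inj => -[|k]; first by rewrite !psum0.
have := psumD (farey_subst p q false (fun=> true)) a k.+1.
rewrite !psum_farey_subst_true.
have := psum_farey_subst true (fun=> false) (ltn0Sn k).
have -> : a * p %/ q = t.-1.
  have -> : a * p = t.-1 * q + q.-1 by case: t et => //; lia.
  by rewrite divnMDl // divn_small ?addn0 //; lia.
have t0 : 0 < t by case: t et.
case: (boolP (q %| k.+1)) => qk.
  have : q %| k.+1 * p by rewrite dvdn_mulr.
  case/dvdnP => u eu; have -> : (a + k.+1) * p = (t.-1 + u) * q + q.-1.
    rewrite mulnDl eu; case: t et t0 => // t et _; lia.
  rewrite eu mulnK // divnMDl // divn_small; lia.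
have qkp : ~~ (q %| k.+1 * p) by rewrite Gauss_dvdl // coprime_sym.
have := divn_eq (k.+1 * p) q; have : 0 < (k.+1 * p) %% q by rewrite lt0n.
have := ltn_pmod (k.+1 * p) q0; set u := _ %/ q; set v := _ %% q => v1 v0 ev.
have -> : (a + k.+1) * p = (t + u) * q + v.-1 by rewrite mulnDl ev; lia.
rewrite divnMDl // (divn_small (_ : v.-1 < q)); lia.
Qed.

Lemma shift_farey_subst_period c x n : 0 < n -> shiftn n x = x -> x n.-1 = ~~ c ->
  shiftn (n * q) (farey_subst p q c x) = farey_subst p q c x.
Proof. by case: n => // n _ nx xn; rewrite shift_farey_subst nx xn negbK. Qed.

Lemma farey_subst_infinitely c x b N : exists2 k, N <= k & farey_subst p q c x k = b.
Proof.
have NN : N <= N * q by rewrite leq_pmulr.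
have [xN|xN] := eqVneq (x N) b.
  by exists (N * q + q.-1); rewrite ?farey_subst_last //; lia.
exists (N.+1 * q); first by lia.
by rewrite farey_subst_first; case: (x N) b xN => -[].
Qed.

Lemma psum_mul x n k : shiftn n x = x -> psum x (k * n) = k * psum x n.
Proof.
move=> nx; elim: k => [|k IH]; first by rewrite psum0.
by rewrite mulSn psumD nx IH mulSn.
Qed.

(** If n were a period not divisible by q, the first n digits would contain
floor(n p/q) ones, less than n p/q.  Over 2 q n digits the deficit would be at
least 2, whereas the counting function allows only 1. *)
Lemma farey_subst_period_dvd x n :
  shiftn n (farey_subst p q false x) = farey_subst p q false x -> q %| n.
Proof.
move=> nS; apply/negPn/negP => qn.
have n0 : 0 < n by case: n qn {nS} => //; rewrite dvdn0.
have := psum_mul (2 * q) nS; rewrite (psum_farey_subst_ndvd false x qn).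
have := psum_farey_subst_dvd false x (2 * n).-1.
have -> : (2 * n).-1.+1 = 2 * n by lia.
have -> : 2 * n * q = 2 * q * n by lia.
move=> e1 e2; rewrite e2 in e1.
have qnp : ~~ (q %| n * p) by rewrite Gauss_dvdl // coprime_sym.
have := divn_eq (n * p) q; have : 0 < (n * p) %% q by rewrite lt0n.
set u := _ %/ q in e1 *; set v := _ %% q => v0 ev.
move: e1; case: (x _) => /=; nia.
Qed.

(** Cut the window at the first place where e falls below 1 theta(111...).  Up to
there e has one 1 less than the bounding sequence, hence at most its linear
share; the remainder is a shorter window, bounded by induction. *)
Lemma window_le e : (forall k, lexle (shiftn k e) (farey_subst p q true (fun=> true))) ->
  forall j k, psum (shiftn j e) k * q <= k * p + q.
Proof.
set u := farey_subst _ _ _ _ => eu j k.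
have U n : psum u n * q <= n * p + q.
  case: n => [|n]; first by rewrite psum0.
  have : psum u n.+1 <= 1 + n.+1 * p %/ q.
    by have := psum_farey_subst true (fun=> true) (ltn0Sn n); rewrite -/u; lia.
  by rewrite -(leq_pmul2r q0) mulnDl; have := leq_trunc_div (n.+1 * p) q; lia.
elim/ltn_ind: k j => k IH j.
have [kn|[n nk [eqn un]]] : (psum (shiftn j e) k = psum u k) \/
    (exists2 n, n < k & psum (shiftn j e) n.+1 = psum u n /\ u n = true).
- case: (eu j) => [->|[n [eqn e0 u1]]]; first by left.
  have [kn|nk] := leqP k n.
    by left; apply: psum_eq => i ik; apply: eqn; apply: leq_trans kn.
  by right; exists n => //; rewrite psumS e0 (psum_eq eqn) addn0.
- by rewrite kn.
- have := psumD (shiftn j e) n.+1 (k - n.+1); rewrite subnKC // eqn shift_shift => ->.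
  have := IH (k - n.+1) _ (j + n.+1); rewrite ltn_subrL (leq_trans _ nk) // => /(_ isT).
  have : psum u n * q <= n.+1 * p.
    by have := U n.+1; rewrite psumS un mulnDl mul1n leq_add2r.
  have : n.+1 * p + (k - n.+1) * p = k * p by rewrite -mulnDl subnKC.
  by move=> *; rewrite mulnDl; lia.
Qed.

Lemma window_ge e : (forall k, lexle (farey_subst p q false (fun=> false)) (shiftn k e)) ->
  forall j k, k * p <= psum (shiftn j e) k * q + q.
Proof.
set u := farey_subst _ _ _ _ => eu j k.
have U n : n * p <= psum u n * q + q.
  case: n => [|n]; first by rewrite psum0.
  have : n.+1 * p %/ q + ~~ (q %| n.+1) = psum u n.+1 + 1.
    by have := psum_farey_subst false (fun=> false) (ltn0Sn n); rewrite -/u; lia.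
  have [qn|qn] := boolP (q %| n.+1); last by have := ltn_ceil (n.+1 * p) q0; lia.
  move/(congr1 (muln^~ q)); rewrite /= addn0 divnK ?dvdn_mulr // => ->; lia.
elim/ltn_ind: k j => k IH j.
have [kn|[n nk [eqn un]]] : (psum (shiftn j e) k = psum u k) \/
    (exists2 n, n < k & psum (shiftn j e) n.+1 = (psum u n).+1 /\ u n = false).
- case: (eu j) => [->|[n [eqn e0 u1]]]; first by left.
  have [kn|nk] := leqP k n.
    by left; apply: psum_eq => i ik; rewrite eqn //; apply: leq_trans kn.
  right; exists n => //; rewrite psumS u1 addn1; split=> //; congr _.+1.
  by apply: psum_eq => i ik; rewrite eqn.
- by rewrite kn.
- have := psumD (shiftn j e) n.+1 (k - n.+1); rewrite subnKC // eqn shift_shift => ->.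
  have := IH (k - n.+1) _ (j + n.+1); rewrite ltn_subrL (leq_trans _ nk) // => /(_ isT).
  have : n.+1 * p <= (psum u n).+1 * q.
    by have := U n.+1; rewrite psumS un; lia.
  have : n.+1 * p + (k - n.+1) * p = k * p by rewrite -mulnDl subnKC.
  by move=> *; rewrite mulnDl; lia.
Qed.

(** Let D(k) be q times the count of e up to k, minus k p.  By the window bounds D
is bounded; start at a place where D is maximal.  From there every count is at
most k p/q and at least k p/q - 1, which determines it except at the multiples
of q, where one binary choice is left: these choices form g. *)
Lemma desubstitute e :
  (forall k, lexle (shiftn k e) (farey_subst p q true (fun=> true))) ->
  (forall k, lexle (farey_subst p q false (fun=> false)) (shiftn k e)) ->
  exists j g, shiftn j e = farey_subst p q false g.
Proof.
move=> /window_le le /window_ge ge.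
pose h k := psum e k * q + q - k * p.
have hE k : h k + k * p = psum e k * q + q.
  by rewrite /h subnK //; have := ge 0 k; rewrite shift0.
have hle k : h k <= 2 * q.
  have := le 0 k; have := hE k; rewrite shift0; lia.
have exP : exists v, `[< exists k, h k = v >] by exists (h 0); apply/asboolP; exists 0.
have leP v : `[< exists k, h k = v >] -> v <= 2 * q.
  by move=> /asboolP[k <-].
case: (ex_maxnP exP leP) => v /asboolP[j jv] maxv.
have W k : psum (shiftn j e) k * q <= k * p.
  have hk : h (j + k) <= h j by rewrite jv; apply: maxv; apply/asboolP; exists (j + k).
  have := hE (j + k); have := hE j; rewrite psumD !mulnDl; lia.
(* The count up to the (i + 1)-st multiple of q takes its larger value exactly
   when the digit before it is 1. *)
exists j, (fun i => psum (shiftn j e) (i.+1 * q) == i.+1 * p); apply: psum_inj => -[|k].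
  by rewrite !psum0.
set g := fun i => _.
have := psum_farey_subst false g (ltn0Sn k); have := W k.+1; have := ge j k.+1.
have [/dvdnP[[//|i] ->]|qk] := boolP (q %| k.+1).
  have -> : i.+1 * q * p = i.+1 * p * q by lia.
  rewrite !mulnK // -mulSnr !leq_pmul2r // {2}/g /=.
  by case: eqP => [->|] /=; lia.
rewrite !addn0 => w1 w2 ->; apply/esym/eqP; rewrite eqn_leq leq_divRL // w2 andbT.
rewrite add0n -ltnS ltn_divLR // ltn_neqAle [(psum _ _).+1 * q]mulSnr w1 andbT.
apply: contra qk => /eqP ekp.
by rewrite -(Gauss_dvdl (k.+1) (_ : coprime q p)) 1?coprime_sym // ekp -mulSnr dvdn_mull.
Qed.

Lemma farey_subst_inj c d x y : farey_subst p q c x = farey_subst p q d y -> c = d /\ x = y.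
Proof.
move=> e; split; first by rewrite -(farey_subst_0 c x) e farey_subst_0.
by apply/funext => i; rewrite -(farey_subst_last c x) e farey_subst_last.
Qed.

Lemma shift_farey_subst_dvd_le c x y i : lexle (shiftn i.+1 x) y ->
  lexle (shiftn (i.+1 * q) (farey_subst p q c x)) (farey_subst p q true y).
Proof. by move=> xy; rewrite shift_farey_subst; apply: lexle_farey_subst_digit. Qed.

Lemma lexle_farey_subst_digit0 c x y : lexle x y -> lexle (farey_subst p q false x) (farey_subst p q c y).
Proof. case: c; last exact: lexle_farey_subst. by move=> _; right; apply: lexlt_farey_subst01. Qed.

Lemma farey_subst_max x : (forall i, lexle (shiftn i x) x) ->
  forall k, lexle (shiftn k (farey_subst p q true x)) (farey_subst p q true x).
Proof.
move=> mx k; have [/dvdnP[[|i] ->]|qk] := boolP (q %| k).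
- exact: lexle_refl.
- exact: shift_farey_subst_dvd_le.
- exact: shift_farey_subst_le.
Qed.

Lemma farey_subst_min x : (forall i, lexle x (shiftn i x)) ->
  forall k, lexle (farey_subst p q false x) (shiftn k (farey_subst p q false x)).
Proof.
move=> mx k; have [/dvdnP[[|i] ->]|qk] := boolP (q %| k).
- exact: lexle_refl.
- by rewrite shift_farey_subst; apply: lexle_farey_subst_digit0.
- exact: shift_farey_subst_ge.
Qed.

End Subst.

(** The two counting functions are 1 + floor(k p/q) and the ceiling of
k p'/q', and the former is at most the latter as soon as k p/q < k p'/q'. *)
Lemma farey_subst_slope_lt p q p' q' : 0 < p -> p < q -> 0 < p' -> p' < q' ->
  p * q' < p' * q ->
  lexle (farey_subst p q true (fun=> true)) (farey_subst p' q' true (fun=> false)).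
Proof.
move=> p0 pq p0' pq' lt; have q0 : 0 < q by lia. have q0' : 0 < q' by lia.
apply: psum_lexle => -[|k]; first by rewrite !psum0.
have := psum_farey_subst p0 pq true (fun=> true) (ltn0Sn k).
have := psum_farey_subst p0' pq' true (fun=> false) (ltn0Sn k).
have [qk|_] := boolP (q' %| k.+1); last first.
  suff : k.+1 * p %/ q <= k.+1 * p' %/ q' by lia.
  rewrite leq_divRL // -(leq_pmul2r q0).
  have := leq_trunc_div (k.+1 * p) q; set u := _ %/ q; nia.
suff : k.+1 * p %/ q < k.+1 * p' %/ q' by lia.
case/dvdnP: qk => j jk; rewrite jk.
have -> : j * q' * p' = j * p' * q' by lia.
rewrite mulnK // ltn_divLR //.
have : 0 < j by case: j jk.
nia.
Qed.

End Substitution.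

(** * Iterated substitutions and their extremal sequences *)

Section Iterated.
Local Open Scope nat_scope.

Definition proper (r : rat) : bool := (0 < r < 1)%R.

Lemma numn_denn r : proper r ->
  [/\ 0 < numn r, numn r < denn r & coprime (numn r) (denn r)].
Proof.
case/andP=> r0 r1; rewrite /numn /denn; split; last exact: coprime_num_den.
- by rewrite absz_gt0 gt_eqF // numq_gt0.
- rewrite -ltz_nat !gez0_abs ?denq_ge0 ?numq_ge0 ?ltW //.
  move: r1; rewrite -{1}(divq_num_den r) ltr_pdivrMr ?ltr0z ?denq_gt0 // mul1r.
  by rewrite ltr_int.
Qed.

Definition farey_substs (rs : seq rat) c x := foldr (fun r => farey_subst (numn r) (denn r) c) x rs.

Definition plen (rs : seq rat) := \prod_(r <- rs) denn r.

(** [low] and [high] are the repetitions of the word w_(r_1) • ... • w_(r_n) and of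
its largest rotation.  On the empty list they are 111... and 000..., which
theta_r, preceded by 0 or 1, sends to the repetitions of 0v1 and 1v0. *)
Definition low rs := farey_substs rs false (fun=> true).
Definition high rs := farey_substs rs true (fun=> false).

#[global] Arguments low : simpl never.
#[global] Arguments high : simpl never.

Lemma low_cons r rs : low (r :: rs) = farey_subst (numn r) (denn r) false (low rs).
Proof. by []. Qed.

Lemma high_cons r rs : high (r :: rs) = farey_subst (numn r) (denn r) true (high rs).
Proof. by []. Qed.

Lemma plen_cons r rs : plen (r :: rs) = denn r * plen rs.
Proof. by rewrite /plen big_cons. Qed.

Lemma plen_gt0 rs : all proper rs -> 0 < plen rs.
Proof.
elim: rs => [|r rs IH] /=; first by rewrite /plen big_nil.
by case/andP=> /numn_denn[p0 pq _] /IH h; rewrite plen_cons muln_gt0 h; lia.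
Qed.

Lemma farey_substs_cat rs rs' c x : farey_substs (rs ++ rs') c x = farey_substs rs c (farey_substs rs' c x).
Proof. exact: foldr_cat. Qed.

Lemma farey_substs_period rs c : all proper rs -> let x := farey_substs rs c (fun=> ~~ c) in
  shiftn (plen rs) x = x /\ x (plen rs).-1 = ~~ c.
Proof.
elim: rs => [|r rs IH] //= /andP[/numn_denn[p0 pq pqC] prs].
have [e1 e2] := IH prs; rewrite plen_cons mulnC; split.
  by apply: shift_farey_subst_period => //; apply: plen_gt0.
have := plen_gt0 prs; move: e2; case: plen => // n /= e2 _.
by rewrite (_ : (n.+1 * _).-1 = n * denn r + (denn r).-1) ?farey_subst_last //; lia.
Qed.

Lemma high_max rs : all proper rs -> forall k, lexle (shiftn k (high rs)) (high rs).
Proof.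
elim: rs => [|r rs IH] /=; first by move=> _ k; left.
by case/andP=> /numn_denn[p0 pq pqC] /IH h; apply: farey_subst_max.
Qed.

Lemma low_min rs : all proper rs -> forall k, lexle (low rs) (shiftn k (low rs)).
Proof.
elim: rs => [|r rs IH] /=; first by move=> _ k; left.
by case/andP=> /numn_denn[p0 pq pqC] /IH h; apply: farey_subst_min.
Qed.

(** A shift starting at a block with the digit 1 is 1 theta(z) for a shift z of
the inner [low] that follows a 0; the inner sequence 111... of the empty list
has no such shift. *)
Lemma low_le_high rs : all proper rs -> rs != [::] ->
  forall k, lexle (shiftn k (low rs)) (high rs).
Proof.
elim: rs => [//|r rs IH] /= /andP[/numn_denn[p0 pq pqC] prs] _ k.
have [/dvdnP[[|i] ->]|qk] := boolP (denn r %| k).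
- by right; apply: lexlt_farey_subst01.
- case e : (low rs i).
    by rewrite low_cons shift_farey_subst // e; right; apply: lexlt_farey_subst01.
  by apply: shift_farey_subst_dvd_le => //; apply: IH => //; case: (rs) e.
- exact: shift_farey_subst_le.
Qed.

Lemma shift_period x n k : shiftn n x = x -> shiftn (k * n) x = x.
Proof.
by move=> nx; elim: k => // k IH; rewrite mulSn -shift_shift nx.
Qed.

(** The last digit of the period of [high] is 0, so the block at which the inner
[high] begins starts with 1. *)
Lemma high_shift_low rs : all proper rs -> rs != [::] ->
  exists k, shiftn k (low rs) = high rs.
Proof.
elim: rs => [//|r rs IH] /= /andP[/numn_denn[p0 pq pqC] prs] _.
have [->|rs0] := eqVneq rs [::]; first exact: shift_christoffel.
have [k ke] := IH prs rs0.
have [pl _] := farey_substs_period false prs; have [ph hl] := farey_substs_period true prs.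
have ll := plen_gt0 prs.
exists ((k + plen rs) * denn r).
rewrite low_cons -[k + _]prednK ?addn_gt0 ?ll ?orbT // shift_farey_subst //.
have -> : low rs (k + plen rs).-1 = high rs (plen rs).-1.
  by rewrite -ke /shiftn; congr (low _ _); lia.
rewrite [high _ _]hl prednK ?addn_gt0 ?ll ?orbT //.
by rewrite addnC -shift_shift pl ke.
Qed.

Lemma low_primitive rs n : all proper rs -> 0 < n < plen rs ->
  shiftn n (low rs) <> low rs.
Proof.
elim: rs n => [|r rs IH] n /=; first by rewrite /plen big_nil; case: n.
case/andP=> /numn_denn[p0 pq pqC] prs; rewrite plen_cons => /andP[n0 nl] e.
have /dvdnP[[|j] nj] := farey_subst_period_dvd p0 pq pqC e; first by rewrite nj in n0.
move: e; rewrite nj low_cons shift_farey_subst // => /farey_subst_inj-[//|//|_] /IH; apply=> //.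
by move: nl; rewrite nj mulnC ltn_pmul2l //; lia.
Qed.

Lemma lexlt_farey_substs rs c x y : all proper rs -> lexlt x y ->
  lexlt (farey_substs rs c x) (farey_substs rs c y).
Proof.
elim: rs => [//|r rs IH] /= /andP[/numn_denn[p0 pq pqC] prs] xy.
by apply: lexlt_farey_subst => //; apply: IH.
Qed.

(** Induction on the list of slopes; with no slope left, [low] is the sequence of
ones.  Were all shifts of e above [low], then e would read 0 theta(g) from some
place on.  If the slope is the last one, this is already at most [low].
Otherwise the smallest period of g is that of e divided by q, and since theta
preserves the order, the bounds on the shifts of e pass to those shifts of g
that follow a suitable digit.  They extend to all shifts of g, because g
contains both digits when its smallest period is at least 2, and removing a
leading 0 (or 1) can only increase (or decrease) a sequence.  The induction
hypothesis then contradicts the lower bound. *)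
Lemma low_extremal rs y e : all proper rs ->
  shiftn (plen rs) e = e -> (forall n, 0 < n < plen rs -> shiftn n e <> e) ->
  (forall k, lexlt (shiftn k e) (farey_substs rs true y)) ->
  exists k, lexle (shiftn k e) (low rs).
Proof.
elim: rs e => [|r rs IH] e /=.
  by exists 0; apply: lexle_true.
case/andP=> /numn_denn[p0 pq pqC] prs; rewrite plen_cons => pe mine lte.
set p := numn r in p0 pq pqC lte *; set q := denn r in p0 pq pqC pe mine lte *.
set D := farey_substs rs true y in lte.
apply: contrapT => nle.
have lowlt k : lexlt (low (r :: rs)) (shiftn k e).
  have [//|[le|lt]] := lexltP (low (r :: rs)) (shiftn k e).
    by case: nle; exists k; rewrite -le; left.
  by case: nle; exists k; right.
have [j [g je]] : exists j g, shiftn j e = farey_subst p q false g.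
  apply: desubstitute => // k.
    right; apply: lexlt_le_trans (lte k) _.
    by apply: lexle_farey_subst => //; apply: lexle_true.
  right; apply: lexle_lt_trans (lowlt k).
  by apply: lexle_farey_subst => //; apply: lexle_false.
have shiftg i : shiftn (j + i.+1 * q) e = farey_subst p q (~~ g i) (shiftn i.+1 g).
  by rewrite -shift_shift je shift_farey_subst.
have mulP := plen_gt0 prs.
(* A period of g gives one of e from the place j + 1 on; as e is purely
   periodic, it is a period of e. *)
have gP i : shiftn i g = g -> shiftn (i * q) e = e.
  case: i => // i gi.
  have h : shiftn (j + i.+1 * q).+1 e = shiftn j.+1 e.
    have S a : shiftn a.+1 e = shiftn 1 (shiftn a e) by rewrite shift_shift addn1.
    by rewrite S shiftg gi S je; apply/funext => t; rewrite /shiftn add1n /farey_subst.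
  have [u ju] : exists u, j.+1 <= u * (q * plen rs).
    by exists j.+1; rewrite leq_pmulr // muln_gt0 mulP andbT; lia.
  have := shift_period u pe; move: ju; set N := u * _ => ju pN.
  transitivity (shiftn (N - j.+1) (shiftn (j + i.+1 * q).+1 e)).
    by rewrite -{1}pN !shift_shift; congr (shiftn _ e); lia.
  by rewrite h shift_shift subnKC.
have gper : shiftn (plen rs) g = g.
  have := shiftg (plen rs).-1; rewrite prednK // mulnC addnC -shift_shift pe je.
  by case/farey_subst_inj.
have gmin n : 0 < n < plen rs -> shiftn n g <> g.
  move=> /andP[n0 nl] /gP; apply: mine; rewrite muln_gt0 n0 mulnC ltn_pmul2l ?nl; lia.
have [rs0|rs0] := eqVneq rs [::].
  apply: nle; exists j; rewrite je rs0; apply: lexle_farey_subst => //; exact: lexle_true.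
have pl1 : 1 < plen rs.
  case: (rs) prs rs0 => // r' rs' /= /andP[/numn_denn[p0' pq' _] prs'] _.
  rewrite plen_cons; have := plen_gt0 prs'; nia.
have gex b : exists i0, g i0 = b.
  apply: contrapT => nb; apply: (gmin 1); first by rewrite pl1.
  have gb i : g i = ~~ b.
    by case: (eqVneq (g i) b) => [h|]; [case: nb; exists i | case: (g i); case: (b)].
  by apply/funext => i; rewrite /shiftn !gb.
(* The sequence g is periodic, so a property of its shifts may be checked
   beyond any given place. *)
have back (P : (nat -> bool) -> Prop) i0 :
    (forall i, i0 < i -> P (shiftn i g)) -> forall i, P (shiftn i g).
  move=> h i; have := shift_period i0.+1 gper => <-; rewrite shift_shift.
  by apply: h; rewrite ltn_addr // leq_pmulr.
have glt i : lexlt (shiftn i g) D.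
  have [i0 g0] := gex false; apply: (back (fun x => lexlt x D) i0) => {}i.
  elim: i => // i IHi; rewrite ltnS leq_eqVlt => /orP[/eqP<-|i0i].
    by apply: (@lexlt_farey_substE p q p0 pq true); have := lte (j + i0.+1 * q); rewrite shiftg g0.
  case gi : (g i).
    by apply: lexle_lt_trans (IHi i0i); apply: lexle_shift_true.
  by apply: (@lexlt_farey_substE p q p0 pq true); have := lte (j + i.+1 * q); rewrite shiftg gi.
have ggt i : lexlt (low rs) (shiftn i g).
  have [i0 g0] := gex true; apply: (back (fun x => lexlt (low rs) x) i0) => {}i.
  elim: i => // i IHi; rewrite ltnS leq_eqVlt => /orP[/eqP<-|i0i].
    by apply: (@lexlt_farey_substE p q p0 pq false); have := lowlt (j + i0.+1 * q); rewrite shiftg g0.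
  case gi : (g i).
    by apply: (@lexlt_farey_substE p q p0 pq false); have := lowlt (j + i.+1 * q); rewrite shiftg gi.
  by apply: lexlt_le_trans (IHi i0i) _; apply: lexle_shift_false.
have [k /lexleNgt] := IH g prs gper gmin glt; exact.
Qed.

End Iterated.

(** * The limit sequence *)

Section LimitSequence.
Local Open Scope nat_scope.

(** Apart from the first digit, a digit of c theta(x) depends on strictly earlier
digits of x, because q is at least 2. *)
Lemma farey_subst_local p q c x y k : 1 < q -> (forall j, j < k -> x j = y j) ->
  farey_subst p q c x k = farey_subst p q c y k.
Proof.
move=> q1 xy; rewrite /farey_subst; case: ifP => qk1.
  by apply: xy; case: k qk1 => [|k _]; [rewrite dvdn1; lia | rewrite ltn_Pdiv].
case: ifP => // qk; case: k xy qk1 qk => // k xy _ _; rewrite xy //.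
by have := leq_div k.+1 q; lia.
Qed.

Lemma farey_substs_local rs c x y k : all proper rs -> (forall j, j <= k -> x j = y j) ->
  farey_substs rs c x k = farey_substs rs c y k.
Proof.
elim: rs k => [|r rs IH] k /=; first by move=> _; exact.
case/andP=> /numn_denn[p0 pq pqC] prs xy; apply: farey_subst_local; first by lia.
by move=> j jk; apply: IH => // i ij; apply: xy; lia.
Qed.

Lemma farey_substs_prefix rs c x y k : all proper rs -> k < size rs ->
  farey_substs rs c x k = farey_substs rs c y k.
Proof.
elim: rs k => [|r rs IH] k //= /andP[/numn_denn[p0 pq pqC] prs] kr.
by apply: farey_subst_local; [lia | move=> j jk; apply: IH => //; lia].
Qed.

(** The digit k is already determined by the first k + 1 slopes
([farey_substs_prefix]), so the diagonal is the limit of the sequences [high]. *)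
Definition delta (r : nat -> rat) : nat -> bool := fun k => high (mkseq r k.+1) k.

Lemma mkseqD T (f : nat -> T) m n :
  mkseq f (m + n) = mkseq f m ++ mkseq (fun i => f (m + i)) n.
Proof. by rewrite /mkseq iotaD map_cat add0n -[in LHS](addn0 m) iotaDl -map_comp addn0. Qed.

Lemma proper_mkseq r n : (forall i, proper (r i)) -> all proper (mkseq r n).
Proof. by move=> pr; apply/allP => _ /mapP[i _ ->]. Qed.

Section Delta.
Variable r : nat -> rat.
Hypothesis pr : forall i, proper (r i).

Lemma delta_high k n : k < n -> delta r k = high (mkseq r n) k.
Proof.
move=> kn; rewrite /delta -(subnKC kn) mkseqD /high farey_substs_cat.
by apply: farey_substs_prefix; rewrite ?size_mkseq // proper_mkseq.
Qed.

Lemma delta_max k : lexle (shiftn k (delta r)) (delta r).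
Proof.
apply/lexleNgt => -[n [eqn d0 d1]].
have := @high_max (mkseq r (k + n).+1) (proper_mkseq _ pr) k; move/lexleNgt; apply.
have H i : i <= k + n -> high (mkseq r (k + n).+1) i = delta r i.
  by move=> ik; rewrite (@delta_high i (k + n).+1).
exists n; rewrite /shiftn !H ?leq_addl //; split=> // i ik.
by rewrite H; [rewrite H; [exact: eqn | lia] | lia].
Qed.

End Delta.

Lemma delta0 r : (forall i, proper (r i)) -> delta r 0 = true.
Proof.
move=> pr; rewrite /delta /= high_cons farey_subst_0 //.
- by case/numn_denn: (pr 0).
- by case/numn_denn: (pr 0).
Qed.

Lemma delta_subs r n : (forall i, proper (r i)) ->
  delta r = farey_substs (mkseq r n) true (delta (fun i => r (n + i))).
Proof.
move=> pr; apply/funext => k.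
rewrite (@delta_high r pr k (n + k.+1)); last by lia.
rewrite mkseqD /high farey_substs_cat; apply: farey_substs_local; first exact: proper_mkseq.
by move=> j jk; rewrite (@delta_high _ _ j k.+1).
Qed.

Lemma delta_infinitely r b N : (forall i, proper (r i)) ->
  exists2 k, N <= k & delta r k = b.
Proof.
move=> pr; rewrite (delta_subs 1 pr) /=; case/numn_denn: (pr 0) => *.
exact: farey_subst_infinitely.
Qed.

Lemma high_infinitely rs b N : all proper rs -> rs != [::] ->
  exists2 k, N <= k & high rs k = b.
Proof.
case: rs => //= r rs /andP[/numn_denn[p0 pq pqC] prs] _; rewrite high_cons.
exact: farey_subst_infinitely.
Qed.

Lemma high_lt_delta r n : (forall i, proper (r i)) ->
  lexlt (high (mkseq r n)) (delta r).
Proof.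
move=> pr; rewrite (delta_subs n pr); apply: lexlt_farey_substs.
  exact: proper_mkseq.
by exists 0; rewrite delta0.
Qed.

Lemma lt_numn_denn r r' : proper r -> proper r' -> (r < r')%R ->
  numn r * denn r' < numn r' * denn r.
Proof.
move=> /andP[r0 _] /andP[r0' _].
rewrite -{1}(divq_num_den r) -{1}(divq_num_den r').
rewrite ltr_pdivrMr ?ltr0z ?denq_gt0 // mulrAC ltr_pdivlMr ?ltr0z ?denq_gt0 //.
rewrite -!intrM ltr_int /numn /denn -ltz_nat !PoszM.
by rewrite !gez0_abs ?denq_ge0 ?numq_ge0 ?ltW.
Qed.

(** After the common slopes are removed by monotonicity, [delta] is below
1 theta_r(111...), [high] is at least 1 theta_r'(000...), and slopes separate. *)
Lemma delta_lt_high r rs j : (forall i, proper (r i)) -> all proper rs ->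
  j < size rs -> (forall i, i < j -> nth 0%R rs i = r i) -> (r j < nth 0%R rs j)%R ->
  lexlt (delta r) (high rs).
Proof.
move=> pr prs js eqr ltr.
have ers : rs = mkseq r j ++ nth 0%R rs j :: drop j.+1 rs.
  rewrite -{1}(cat_take_drop j rs) (drop_nth 0%R) //; congr (_ ++ _).
  apply: (@eq_from_nth _ 0%R); rewrite size_take js ?size_mkseq // => i ij.
  by rewrite nth_take // nth_mkseq // eqr.
have pj : proper (nth 0%R rs j) by apply: (allP prs); apply: mem_nth.
rewrite (delta_subs j pr) ers /high farey_substs_cat; apply: lexlt_farey_substs.
  exact: proper_mkseq.
have pr' i : proper (r (j + i)) by [].
rewrite (delta_subs 1 pr') /= addn0.
have [p0 pq pqC] := numn_denn (pr j); have [p0' pq' pqC'] := numn_denn pj.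
apply: (@lexlt_le_trans (farey_subst (numn (r j)) (denn (r j)) true (fun=> true))).
  apply: lexlt_farey_subst => //.
  set d := delta _; have [k _ dk] : exists2 k, 0 <= k & d k = false.
    by apply: delta_infinitely.
  by case: (lexle_true d) => // dt; rewrite dt in dk.
apply: (lexle_trans (farey_subst_slope_lt p0 pq p0' pq' (lt_numn_denn (pr j) pj ltr))).
by apply: lexle_farey_subst => //; apply: lexle_false.
Qed.

End LimitSequence.

(** * Words: the bullet operation as an iterated substitution *)

Section Words.
Local Open Scope nat_scope.

(** The product s • x on infinite sequences, where s has length M and a is its
largest rotation.  The first block has no preceding digit of x to determine its
beginning, so c prescribes it. *)
Definition blocks M (s a : nat -> bool) c (x : nat -> bool) : nat -> bool := fun k =>
  if k %% M == M.-1 then x (k %/ M)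
  else if (if k %/ M is i.+1 then ~~ x i else c) then a (k %% M) else s (k %% M).

Lemma blocksE M s a c x i j : j < M -> blocks M s a c x (i * M + j) =
  if j == M.-1 then x i
  else if (if i is i.+1 then ~~ x i else c) then a j else s j.
Proof.
move=> jM; have M0 : 0 < M by lia.
by rewrite /blocks divnMDl // modnMDl modn_small // divn_small // addn0.
Qed.

(** Associativity of the bullet operation: composing the substitutions of the
slopes rs amounts to the block construction with the product word and its
largest rotation.  On the empty list the blocks have length 1. *)
Lemma farey_substs_blocks rs c x : all proper rs ->
  farey_substs rs c x = blocks (plen rs) (low rs) (high rs) c x.
Proof.
elim: rs => [|r rs IH] /=.
  by move=> _; apply/funext => k; rewrite /plen big_nil /blocks modn1 divn1.
case/andP=> /numn_denn[p0 pq pqC] prs; rewrite IH // plen_cons low_cons high_cons.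
have := plen_gt0 prs; set M := plen rs; set p := numn r in p0 pq pqC *.
set q := denn r in p0 pq pqC * => M0.
apply/funext => k; have q0 : 0 < q by lia.
rewrite (divn_eq k q) (divn_eq (k %/ q) M).
have := ltn_pmod k q0; have := ltn_pmod (k %/ q) M0.
set l := k %% q; set j := _ %% M; set i := _ %/ M => jM lq.
have -> : (i * M + j) * q + l = i * (q * M) + (j * q + l) by lia.
have jlM : j * q + l < q * M.
  by apply: (@leq_trans (j.+1 * q)); [lia | rewrite mulnC leq_mul2l jM orbT].
rewrite blocksE //.
have -> : i * (q * M) + (j * q + l) = (i * M + j) * q + l by lia.
have [lq1|lq1] := eqVneq l q.-1.
  rewrite lq1 !farey_subst_last // blocksE //.
  have -> : (j * q + q.-1 == (q * M).-1) = (j == M.-1).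
    apply/eqP/eqP => [h|->]; last by case: (M) M0 => //; lia.
    by apply/eqP; rewrite -(eqn_pmul2r q0); apply/eqP; case: (M) M0 h => //=; lia.
  by case: ifP => // _; case: ifP.
have -> : (j * q + l == (q * M).-1) = false.
  apply/eqP => h; have : j.+1 * q <= q * M by rewrite mulnC leq_mul2l jM orbT.
  by lia.
have [l0|l0] := eqVneq l 0; last first.
  have nd t : ~~ (q %| t * q + l).
    by rewrite dvdn_addr ?dvdn_mull // gtnNdvd ?lt0n.
  have nd1 t : ~~ (q %| (t * q + l).+1).
    by rewrite -addnS dvdn_addr ?dvdn_mull // gtnNdvd //; lia.
  by rewrite !farey_subst_mid // !mech_add //; case: ifP.
rewrite l0 !addn0.
case: j jM {jlM} => [|j] jM.
  rewrite addn0 mul0n !farey_subst_0 //.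
  have <- : (if (if i is i'.+1 then ~~ x i' else c) then true else false) =
    (if i is i'.+1 then ~~ x i' else c) by case: i => [|i]; [case: (c)|case: (x i)].
  case: i => [|i]; first by rewrite farey_subst_0 //; case: (c).
  have -> : i.+1 * M = (i * M + M.-1).+1 by rewrite mulSn; lia.
  rewrite (farey_subst_first p0 pq) blocksE; last by lia.
  by rewrite eqxx; case: (x i).
rewrite addnS !(farey_subst_first p0 pq) blocksE; last by lia.
have -> : (j == M.-1) = false by lia.
by case: ifP.
Qed.

Lemma farey_substs_rcons rs r c x : farey_substs (rcons rs r) c x = farey_substs rs c (farey_subst (numn r) (denn r) c x).
Proof. by rewrite -cats1 farey_substs_cat. Qed.

Lemma plen_rcons rs r : plen (rcons rs r) = plen rs * denn r.
Proof. by rewrite /plen -cats1 big_cat /= big_seq1. Qed.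

Section Bullet.
Variables (s : word) (M : nat).
Hypothesis M0 : 0 < M.
Hypothesis sM : size s = M.
Hypothesis LM : size (Lmax s) = M.
Hypothesis slast : nth false s M.-1 = true.
Hypothesis Llast : nth false (Lmax s) M.-1 = false.

Let f c (x : word) := blocks M (nth false s) (nth false (Lmax s)) c (nth false x).

Lemma bullet_blockE a b : bullet_block s a b =
  mkseq (fun k => if k == M.-1 then b
                  else if ~~ a then nth false (Lmax s) k else nth false s k) M.
Proof.
apply: (@eq_from_nth _ false).
  by case: a; case: b; rewrite /= ?size_set_nth size_mkseq ?sM ?LM; lia.
have -> : size (bullet_block s a b) = M.
  by case: a; case: b; rewrite /= ?size_set_nth ?sM ?LM; lia.
move=> i iM; rewrite nth_mkseq //.
by case: a; case: b; rewrite /= ?nth_set_nth /= ?sM ?LM; case: eqP => // ->.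
Qed.

(** The first block of a product is the one that would follow the opposite digit,
so the product is a single instance of the general rule for blocks. *)
Lemma bullet_pairmap a x :
  flatten (pairmap (bullet_block s) a x) = mkseq (f (~~ a) x) (M * size x).
Proof.
elim: x a => [|b x IH] a /=; first by rewrite muln0.
rewrite mulnS mkseqD IH bullet_blockE; congr (_ ++ _); apply/eq_in_map => k.
  rewrite mem_iota add0n => /andP[_ kM].
  by have := blocksE (nth false s) (nth false (Lmax s)) (~~ a) (nth false (b :: x)) 0 kM.
move=> _; rewrite /f /blocks.
have -> : (M + k) %/ M = (k %/ M).+1 by rewrite -{1}[M]mul1n divnMDl.
by rewrite modnDl /=; case: (k %/ M).
Qed.

Lemma bulletE b x : bullet s (b :: x) = mkseq (f b (b :: x)) (M * (size x).+1).
Proof.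
have -> : bullet s (b :: x) = flatten (pairmap (bullet_block s) (~~ b) (b :: x)).
  by case: b.
by rewrite bullet_pairmap negbK.
Qed.

End Bullet.

Lemma mkseq_lexle (x y : nat -> bool) n : lexle x y ->
  (mkseq x n <= mkseq y n :> seqlexi bool)%O.
Proof.
case=> [->//|]; elim: n x y => [//|n IH] x y [k [eqk xk yk]].
rewrite -[n.+1]add1n !mkseqD /= Order.SeqLexiOrder.Exports.lexi_cons.
case: k eqk xk yk => [_ -> ->|k eqk xk yk] //.
rewrite eqk // lexx /=; apply: IH; exists k; split=> // i ik; exact: eqk.
Qed.

Lemma period_mod (x : nat -> bool) n i : shiftn n x = x -> x (i %% n) = x i.
Proof.
move=> nx; rewrite [in RHS](divn_eq i n).
by have := shift_period (i %/ n) nx => /(congr1 (fun y => y (i %% n))).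
Qed.

Lemma winfty_mkseq (x : nat -> bool) n : 0 < n -> shiftn n x = x ->
  winfty (mkseq x n) = x.
Proof.
move=> n0 nx; apply/funext => i.
by rewrite /winfty size_mkseq nth_mkseq ?ltn_pmod // period_mod.
Qed.

Lemma rot_mkseq (x : nat -> bool) n k : k <= n -> shiftn n x = x ->
  rot k (mkseq x n) = mkseq (shiftn k x) n.
Proof.
move=> kn nx; have e1 : mkseq x n = mkseq x k ++ mkseq (shiftn k x) (n - k).
  by rewrite -mkseqD subnKC.
have -> : rot k (mkseq x n) = mkseq (shiftn k x) (n - k) ++ mkseq x k.
  by rewrite e1 -{1}(size_mkseq x k) rot_size_cat.
rewrite -[in RHS](subnK kn) mkseqD; congr (_ ++ _).
apply: eq_mkseq => i; rewrite -[in LHS]nx /shiftn; congr x; lia.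
Qed.

Lemma Lmax_low rs : all proper rs -> rs != [::] ->
  Lmax (mkseq (low rs) (plen rs)) = mkseq (high rs) (plen rs).
Proof.
move=> prs rs0; have M0 := plen_gt0 prs.
have [pl _] := farey_substs_period false prs.
have [k kh] := high_shift_low prs rs0.
have kM : k %% plen rs < plen rs by rewrite ltn_pmod.
have {}kh : shiftn (k %% plen rs) (low rs) = high rs.
  rewrite -kh {2}(divn_eq k (plen rs)) -shift_shift.
  by congr shiftn; have := shift_period (k %/ plen rs) pl.
rewrite /Lmax size_mkseq; apply: (@le_anti _ (seqlexi bool)); apply/andP; split.
  apply/bigmax_leP; split => [|i _]; first exact: Order.SeqLexiOrder.Exports.lexi0s.
  rewrite rot_mkseq //; last exact: ltnW.
  by apply: mkseq_lexle; apply: low_le_high.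
have := @le_bigmax _ (seqlexi bool) 'I_(plen rs) [::]
  (fun k : 'I_(plen rs) => rot k (mkseq (low rs) (plen rs)) : seqlexi bool) (Ordinal kM).
by rewrite rot_mkseq //= ?kh //; exact: ltnW.
Qed.

Lemma bullets_rcons ws w : bullets (rcons ws w) =
  if ws is [::] then w else bullet (bullets ws) w.
Proof. by case: ws => //= v ws; rewrite foldl_rcons. Qed.

Lemma low1 r : proper r -> low [:: r] = mech (numn r) (denn r).
Proof.
case/numn_denn=> p0 pq _; apply/funext => k; rewrite low_cons /low /= /farey_subst.
case: ifP => qk1; first by rewrite mech_dvdS.
by case: ifP => // qk; rewrite mech_dvd //; case: (k).
Qed.

Lemma farey_low r : proper r -> farey r = mkseq (low [:: r]) (denn r).
Proof. by move=> pr; rewrite low1. Qed.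

Lemma farey_bullets_low rs : all proper rs -> rs != [::] ->
  farey_bullets rs = mkseq (low rs) (plen rs).
Proof.
elim/last_ind: rs => [//|rs r IH]; rewrite all_rcons => /andP[pr prs] _.
rewrite /farey_bullets map_rcons bullets_rcons.
case: (eqVneq rs [::]) => [->|rs0] /=.
  by rewrite farey_low // /plen big_seq1.
have -> : bullets [seq farey r0 | r0 <- rs] = mkseq (low rs) (plen rs) by exact: IH.
case e : [seq farey i | i <- rs] => [|w ws].
  by move/(congr1 size): e rs0; rewrite size_map; case: (rs).
have [pl ll] := farey_substs_period false prs; have [ph lh] := farey_substs_period true prs.
have M0 := plen_gt0 prs; have [p0 pq _] := numn_denn pr.
have fn i : i < denn r -> nth false (farey r) i = low [:: r] i.
  by move=> ir; rewrite farey_low // nth_mkseq.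
case ef : (farey r) => [|b x].
  by move/(congr1 size): ef; rewrite farey_low // size_mkseq /= => dr; move: pq; rewrite dr.
have b0 : b = false.
  by have := fn 0; rewrite ef low_cons (farey_subst_0 p0 pq) /= => -> //; lia.
have sx : (size x).+1 = denn r.
  by move/(congr1 size): ef; rewrite farey_low // size_mkseq => ->.
rewrite (@bulletE _ (plen rs)) ?Lmax_low ?size_mkseq ?nth_mkseq ?prednK //.
rewrite sx plen_rcons -ef b0; apply/eq_in_map => k; rewrite mem_iota add0n => /andP[_ kM].
rewrite [in RHS]/low farey_substs_rcons farey_substs_blocks // /blocks.
have km : k %% plen rs < plen rs by rewrite ltn_pmod.
have kd : k %/ plen rs < denn r by rewrite ltn_divLR // mulnC.
rewrite fn // !(nth_mkseq _ _ km); case: ifP => // _.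
by case ek : (k %/ plen rs) kd => [|i] // id; rewrite fn // ltnW.
Qed.

Lemma winfty_low rs : all proper rs -> rs != [::] ->
  winfty (farey_bullets rs) = low rs.
Proof.
move=> prs rs0; rewrite farey_bullets_low //; apply: winfty_mkseq.
  exact: plen_gt0.
by have [] := farey_substs_period false prs.
Qed.

Lemma winfty_high rs : all proper rs -> rs != [::] ->
  winfty (Lmax (farey_bullets rs)) = high rs.
Proof.
move=> prs rs0; rewrite farey_bullets_low // Lmax_low //; apply: winfty_mkseq.
  exact: plen_gt0.
by have [] := farey_substs_period true prs.
Qed.

End Words.

(** * Values of expansions as functions of the base *)

Section Value.
Variable R : realType.
Local Open Scope classical_set_scope.
Local Open Scope ring_scope.
Implicit Types (d e : nat -> bool) (b : R).

Notation V := (@expansion_value R).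

Definition pval d b n : R := series (fun i : nat => (d i)%:R / b ^+ i.+1) n.

Lemma pval0 d b : pval d b 0 = 0.
Proof. by rewrite /pval /series /= big_geq. Qed.

Lemma pvalS d b n : b != 0 ->
  pval d b n.+1 = ((d 0%N)%:R + pval (shiftn 1 d) b n) / b.
Proof.
move=> b0; rewrite /pval /series /= big_nat_recl // expr1 mulrDl mulr_suml.
congr (_ + _); apply: eq_bigr => i _.
by rewrite /shiftn add1n [in LHS]exprS invfM mulrA mulrAC.
Qed.

Lemma pval_homo d b : 0 < b -> nondecreasing_seq (pval d b).
Proof.
move=> b0; apply: nondecreasing_series => n _ _.
by rewrite divr_ge0 ?ler0n // exprn_ge0 // ltW.
Qed.

Lemma pval_le d b n : 1 < b -> pval d b n <= (b - 1)^-1.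
Proof.
move=> b1; have b0 : 0 < b by apply: lt_trans b1.
elim: n d => [|n IH] d; first by rewrite pval0 invr_ge0 subr_ge0 ltW.
rewrite pvalS ?gt_eqF // ler_pdivrMr //.
have : (d 0%N)%:R <= 1 :> R by rewrite lern1; case: (d _).
have := IH (shiftn 1 d); set u := _^-1 => h1 h2.
have -> : u * b = 1 + u by rewrite /u; field; lra.
exact: lerD.
Qed.

Lemma pval_cvg d b : 1 < b -> cvgn (pval d b).
Proof.
move=> b1; apply: nondecreasing_is_cvgn; first by apply: pval_homo; lra.
by exists (b - 1)^-1 => _ [n _ <-]; apply: pval_le.
Qed.

Lemma pval_le_V d b n : 1 < b -> pval d b n <= V d b.
Proof.
move=> b1; apply: (nondecreasing_cvgn_le _ (pval_cvg b1)).
by apply: pval_homo; lra.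
Qed.

Lemma V_le d b c : 1 < b -> (forall n, pval d b n <= c) -> V d b <= c.
Proof. by move=> b1 h; apply: limr_le; [exact: pval_cvg | apply: nearW]. Qed.

Lemma V_ge0 d b : 1 < b -> 0 <= V d b.
Proof. by move=> b1; rewrite -(pval0 d b) pval_le_V. Qed.

#[global] Arguments pval : simpl never.

Lemma V_step d b : 1 < b -> V d b = ((d 0%N)%:R + V (shiftn 1 d) b) / b.
Proof.
move=> b1; have b0 : 0 < b by lra.
apply/eqP; rewrite eq_le; apply/andP; split.
  apply: V_le => // -[|n].
    by rewrite pval0 divr_ge0 ?addr_ge0 ?ler0n ?V_ge0 // ltW.
  by rewrite pvalS ?gt_eqF // ler_pM2r ?invr_gt0 // lerD2l pval_le_V.
rewrite ler_pdivrMr // -lerBrDl; apply: V_le => // n.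
by rewrite lerBrDl -ler_pdivrMr // -pvalS ?gt_eqF // pval_le_V.
Qed.

Lemma V_anti d b c : 1 < b -> b <= c -> V d c <= V d b.
Proof.
move=> b1 bc; apply: V_le => [|n]; first by lra.
apply: le_trans (pval_le_V d n b1); apply: ler_sum => i _.
rewrite ler_wpM2l ?ler0n // lef_pV2 ?posrE ?exprn_gt0 //; try lra.
by apply: lerXn2r; rewrite ?nnegrE //; lra.
Qed.

(** Since b times the value in base b is the first digit plus the value of the
shifted sequence, a bound K for the difference in bases b < c propagates from
shifted sequences to sequences provided (c - b)/(a - 1) + K <= K a, which
K = (c - b)/(a - 1)^2 satisfies with equality. *)
Lemma V_lipschitz d a b c : 1 < a -> a <= b -> b <= c ->
  V d b <= V d c + (c - b) / (a - 1) ^+ 2.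
Proof.
move=> a1 ab bc; set K := _ / _.
suff h n : pval d b n <= pval d c n + K.
  apply: V_le => [|n]; first by lra.
  by apply: (le_trans (h n)); rewrite lerD2r pval_le_V //; lra.
have K0 : 0 <= K by rewrite divr_ge0 ?exprn_ge0 //; lra.
elim: n d => [|n IH] d; first by rewrite !pval0 add0r.
rewrite !pvalS ?gt_eqF //; try lra.
set x := (d 0%N)%:R + _; set y := (d 0%N)%:R + _.
have xy : x <= y + K by rewrite /x /y -addrA lerD2l.
have yb : y / c <= (a - 1)^-1.
  rewrite /y -pvalS ?gt_eqF //; last by lra.
  apply: (le_trans (pval_le _ _ _)); first by lra.
  by rewrite lef_pV2 ?posrE; lra.
rewrite ler_pdivrMr; last by lra.
apply: (le_trans xy).
have yE : y = y / c * c by rewrite divfK //; lra.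
have y0 : 0 <= y / c.
  rewrite /y -pvalS ?gt_eqF //; last by lra.
  by rewrite -(pval0 d c); apply: pval_homo => //; lra.
rewrite {1}yE; set z := y / c in yb y0 *.
have Ka : K * (a - 1) = (c - b) * (a - 1)^-1 by rewrite /K; field; lra.
have : z * (c - b) <= K * (a - 1).
  by rewrite Ka mulrC ler_wpM2l //; lra.
have : K * (a - 1) <= K * (b - 1) by rewrite ler_wpM2l //; lra.
lra.
Qed.

Lemma V_continuous d b : 1 < b -> {for b, continuous (V d)}.
Proof.
move=> b1; pose a := (1 + b) / 2; pose K := ((a - 1) ^+ 2)^-1.
have a1 : 1 < a by rewrite /a; lra.
have ab : a < b by rewrite /a; lra.
have K0 : 0 < K by rewrite invr_gt0 exprn_gt0 //; lra.
apply/cvgrPdist_le => eps eps0.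
have eK : 0 < eps / K by rewrite divr_gt0.
near=> c.
have ac : a < c by near: c; exact: lt_nbhsr.
have bc : `|b - c| < eps / K by near: c; exact: cvgr_dist_lt.
have : `|b - c| * K <= eps by rewrite -ler_pdivlMr // ltW.
have [le|lt] := leP b c.
  rewrite (ler0_norm (_ : b - c <= 0)); last by lra.
  have := V_anti d b1 le; have := V_lipschitz d a1 (ltW ab) le.
  rewrite -/K => h1 h2 h3; rewrite ger0_norm; lra.
rewrite (ger0_norm (_ : 0 <= b - c)); last by lra.
have c1 : 1 < c by lra.
have := V_anti d c1 (ltW lt); have := V_lipschitz d a1 (ltW ac) (ltW lt).
rewrite -/K => h1 h2 h3; rewrite ler0_norm; lra.
Unshelve. all: by end_near. Qed.

(** The key formula for comparing values: all comparisons below reduce to bounds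
on the values of the two remainders after the first difference. *)
Lemma V_lex d e n b : 1 < b -> (forall i, (i < n)%N -> d i = e i) ->
  d n = false -> e n = true ->
  V e b - V d b = (1 + V (shiftn n.+1 e) b - V (shiftn n.+1 d) b) / b ^+ n.+1.
Proof.
move=> b1; have b0 : b != 0 by lra.
elim: n d e => [|n IH] d e eqn dn en.
  by rewrite (V_step d b1) (V_step e b1) dn en expr1 /= mulr0n mulr1n; field.
have := IH (shiftn 1 d) (shiftn 1 e) (fun i => eqn i.+1) dn en.
rewrite !shift_shift !add1n => h.
rewrite (V_step d b1) (V_step e b1) eqn // -mulrBl opprD addrACA subrr add0r.
by rewrite exprSr invfM mulrA -h.
Qed.

Lemma V_lt d e b : 1 < b -> lexlt d e -> (forall k, V (shiftn k d) b < 1) ->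
  V d b < V e b.
Proof.
move=> b1 [n [eqn dn en]] lt1; rewrite -subr_gt0 (V_lex b1 eqn dn en).
rewrite divr_gt0 ?exprn_gt0 //; last by lra.
have := lt1 n.+1; have := V_ge0 (shiftn n.+1 e) b1; lra.
Qed.

Lemma V_le_of_lexle d e b : 1 < b -> lexle d e -> (forall k, V (shiftn k d) b < 1) ->
  V d b <= V e b.
Proof. by move=> b1 [->//|lt] /(V_lt b1 lt)/ltW. Qed.

Lemma V_gt0 d b k : 1 < b -> d k = true -> 0 < V d b.
Proof.
move=> b1; elim: k d => [|k IH] d dk; rewrite V_step //.
  by rewrite dk divr_gt0 //=; have := V_ge0 (shiftn 1 d) b1; lra.
have := IH (shiftn 1 d) dk => h; rewrite divr_gt0 //; last by lra.
by rewrite ltr_wpDl ?ler0n.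
Qed.

Lemma le_geometric (x y C b : R) : 1 < b -> (forall n, x <= y + C / b ^+ n) -> x <= y.
Proof.
move=> b1 h; have bV : `|b^-1| < 1 by rewrite ger0_norm ?invr_ge0 ?invf_lt1; lra.
have cv : (fun n => y + C / b ^+ n) @ \oo --> y.
  rewrite -[X in _ --> X]addr0; apply: cvgD; first exact: cvg_cst.
  rewrite (_ : (fun n => C / b ^+ n) = geometric C b^-1); first exact: cvg_geometric.
  by apply/funext => n; rewrite /= exprVn.
rewrite -(cvg_lim (@Rhausdorff R) cv); apply: limr_ge; first by apply: cvgP cv.
exact: nearW.
Qed.

(** If every shift of e were bounded by 1 + C, then the formula for the first
difference would improve the bound to 1 + C/b; iterating, the excess over 1
vanishes. *)
Lemma V_le_one d e b : 1 < b -> V d b = 1 -> (forall k, lexle (shiftn k e) d) ->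
  V e b <= 1.
Proof.
move=> b1 d1 ed; have b0 : 0 < b by lra.
apply: (@le_geometric _ _ (b - 1)^-1 b) => // n.
elim: n e ed => [|n IH] e ed.
  rewrite expr0 divr1; apply: V_le => // n.
  by apply: (le_trans (pval_le _ _ b1)); lra.
have C0 : 0 <= (b - 1)^-1 by rewrite invr_ge0; lra.
have := ed 0%N; rewrite shift0 => -[->|[k [eqk ek dk]]].
  by rewrite d1 lerDl divr_ge0 // exprn_ge0 // ltW.
have := V_lex b1 eqk ek dk; rewrite d1 => h.
have h1 : V (shiftn k.+1 e) b <= 1 + (b - 1)^-1 / b ^+ n.
  by apply: IH => j; rewrite shift_shift.
have h2 := V_ge0 (shiftn k.+1 d) b1.
have h3 : - ((b - 1)^-1 / b ^+ n / b ^+ k.+1) <= 1 - V e b.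
  rewrite h -mulNr ler_pM2r ?invr_gt0 ?exprn_gt0 //; lra.
have h4 : (b - 1)^-1 / b ^+ n / b ^+ k.+1 <= (b - 1)^-1 / b ^+ n.+1.
  rewrite -mulrA -invfM -exprD ler_wpM2l // lef_pV2 ?posrE ?exprn_gt0 //.
  by apply: ler_weXn2l; [lra | lia].
lra.
Qed.

Lemma V_lt_one d e b : 1 < b -> V d b = 1 -> (forall N, exists2 k, (N <= k)%N & d k = true) ->
  (forall k, lexle (shiftn k e) d) -> lexlt e d -> V e b < 1.
Proof.
move=> b1 d1 dinf ed [n [eqn en dn]]; have := V_lex b1 eqn en dn; rewrite d1 => h.
rewrite -subr_gt0 h divr_gt0 ?exprn_gt0 //; last by lra.
have h1 : V (shiftn n.+1 e) b <= 1.
  by apply: (V_le_one b1 d1) => k; rewrite shift_shift.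
have [k nk dk] := dinf n.+1.
have := @V_gt0 (shiftn n.+1 d) b (k - n.+1) b1; rewrite {1}/shiftn subnKC // => /(_ dk).
lra.
Qed.

(** If e exceeded d, the digit gained at the first difference would outweigh the
remainder of d, which is worth at most 1, so e would be worth at least 1. *)
Lemma lexlt_of_V_lt_one d e b : 1 < b -> V d b = 1 ->
  (forall k, lexle (shiftn k d) d) -> V e b < 1 -> lexlt e d.
Proof.
move=> b1 db dmax elt1.
have [//|[ed|[j [eqj dj ej]]]] := lexltP e d; first by move: elt1; rewrite ed db ltxx.
have h1 := V_lex b1 eqj dj ej; rewrite db in h1.
have h2 : V (shiftn j.+1 d) b <= 1.
  by apply: (V_le_one b1 db) => i; rewrite shift_shift; apply: dmax.
have : 0 <= V e b - 1.
  rewrite h1 divr_ge0 ?exprn_ge0 //; last by lra.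
  by have := V_ge0 (shiftn j.+1 e) b1; lra.
by lra.
Qed.

(** In base c all shifts of d stay below e, whose value is 1; hence the value of d
is less than 1 there, and the base giving d the value 1 is smaller. *)
Lemma base_lt d e b c : 1 < b -> 1 < c -> V d b = 1 -> V e c = 1 ->
  (forall N, exists2 k, (N <= k)%N & e k = true) ->
  (forall k, lexle (shiftn k d) d) -> lexlt d e -> b < c.
Proof.
move=> b1 c1 db ec einf dmax de; rewrite ltNge; apply/negP => cb.
have := V_lt_one c1 ec einf _ de; have := V_anti d c1 cb; rewrite db => h1 h2.
suff : V d c < 1 by lra.
by apply: h2 => k; apply: lexle_trans (dmax k) _; right.
Qed.

(** A base b giving d the value 1 equals the first digit plus the value of the
shifted sequence, which does not increase with b. *)
Lemma base_unique d b c : 1 < b -> 1 < c -> V d b = 1 -> V d c = 1 -> b = c.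
Proof.
wlog bc : b c / b <= c.
  move=> h b1 c1 db dc; have [/h->//|/ltW/h h'] := leP b c; exact/esym/h'.
move=> b1 c1; rewrite V_step // (V_step d c1) => db dc.
have {}db : (d 0%N)%:R + V (shiftn 1 d) b = b.
  by move/(congr1 (fun u => u * b)): db; rewrite /= divfK ?mul1r //; lra.
have {}dc : (d 0%N)%:R + V (shiftn 1 d) c = c.
  by move/(congr1 (fun u => u * c)): dc; rewrite /= divfK ?mul1r //; lra.
by have := V_anti (shiftn 1 d) b1 bc; lra.
Qed.

Lemma V2_le d : V d 2 <= 1.
Proof.
apply: V_le => [|n]; first by lra.
apply: (le_trans (pval_le _ _ _)); first by lra.
by rewrite (_ : 2 - 1 = 1 :> R) ?invr1 //; lra.
Qed.

Lemma V2_lt d k : d k = false -> V d 2 < 1.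
Proof.
have two1 : (1 : R) < 2 by lra.
elim: k d => [|k IH] d dk; rewrite V_step //.
  by rewrite dk /= mulr0n; have := V2_le (shiftn 1 d); lra.
have := IH (shiftn 1 d) dk; have : (d 0%N)%:R <= 1 :> R by rewrite lern1; case: (d _).
lra.
Qed.

Lemma bernoulli (x : R) n : 0 <= x <= 1 -> 1 - n%:R * x <= (1 - x) ^+ n.
Proof.
move=> /andP[x0 x1]; elim: n => [|n IH]; first by rewrite mul0r subr0 expr0.
rewrite exprS; have : (1 - x) * (1 - n%:R * x) <= (1 - x) * (1 - x) ^+ n.
  by rewrite ler_wpM2l //; lra.
have : 0 <= n%:R * x * x by rewrite !mulr_ge0.
rewrite -natr1; lra.
Qed.

(** By continuity it suffices to find a base near 1 with value at least 1.  Two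
ones among the first n digits give a value at least 2/b^n, and the base
1/(1 - 1/(2n)) satisfies b^n <= 2 by the Bernoulli inequality. *)
Lemma exists_base d : (forall c N, exists2 k, (N <= k)%N & d k = c) ->
  exists2 b : R, 1 < b < 2 & V d b = 1.
Proof.
move=> dinf; have [k _ dk] := dinf false 0%N.
have [i _ di] := dinf true 0%N; have [j ij dj] := dinf true i.+1.
pose n := j.+1; pose x : R := (2 * n%:R)^-1.
have n1 : 1 <= n%:R :> R by rewrite ler1n.
have x0 : 0 < x by rewrite invr_gt0; lra.
have x12 : x <= 1 / 2 by rewrite /x mul1r lef_pV2 ?posrE; lra.
pose b0 : R := (1 - x)^-1.
have b01 : 1 < b0 by rewrite /b0 invf_gt1; lra.
have b02 : b0 <= 2 by rewrite /b0 -[leRHS]invrK lef_pV2 ?posrE; lra.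
have half : 1 / 2 <= (b0 ^+ n)^-1.
  rewrite /b0 exprVn invrK; apply: le_trans (bernoulli n _); last by apply/andP; lra.
  by rewrite /x invfM mulrCA divff ?mulr1; lra.
have Vb0 : 1 <= V d b0.
  apply: le_trans (pval_le_V d n b01).
  rewrite /pval /series /= (big_cat_nat _ (n := i.+1)) //=; last by lia.
  rewrite big_nat_recr //= di mul1r big_nat_recr //= dj mul1r.
  have pos m1 m2 : 0 <= \sum_(m1 <= l < m2) ((d l)%:R / b0 ^+ l.+1 : R).
    by apply: sumr_ge0 => l _; rewrite divr_ge0 // exprn_ge0 //; lra.
  have := pos 0%N i; have := pos i.+1 j.
  have : (b0 ^+ n)^-1 <= (b0 ^+ i.+1)^-1.
    rewrite lef_pV2 ?posrE ?exprn_gt0 //; try lra.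
    by apply: ler_weXn2l; [lra | rewrite /n; lia].
  rewrite -/n; lra.
have V2 := V2_lt dk.
have [b] : exists2 b, b \in `[b0, 2] & V d b = 1.
  apply: IVT => //.
    by apply: continuous_in_subspaceT => y; rewrite inE /= in_itv /= => /andP[? _];
      apply: V_continuous; lra.
  by rewrite ge_min le_max Vb0 (ltW V2) orbT.
rewrite in_itv /= => /andP[bb b2] db; exists b => //.
rewrite (lt_le_trans b01) //= lt_neqAle b2 andbT.
by apply/eqP => b2e; rewrite b2e in db; lra.
Qed.

(** A larger sequence e with value 1 would, at the first difference, gain a full
digit over d, whereas the remainder of d is worth at most 1 and that of e is
worth more than 0 when e does not end with zeros. *)
Lemma quasi_greedyE d b : 1 < b -> V d b = 1 -> (forall k, lexle (shiftn k d) d) ->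
  (forall N, exists2 k, (N <= k)%N & d k = true) -> quasi_greedy b = d.
Proof.
move=> b1 db dmax dinf.
have nz : ~ ends_with_zeros d.
  by move=> [N dN]; have [k Nk] := dinf N; rewrite dN.
have dtop e : V e b = 1 /\ ~ ends_with_zeros e -> lexle e d.
  move=> [eb ez]; apply/lexleNgt => -[n [eqn dn en]].
  have := V_lex b1 eqn dn en; rewrite eb db subrr.
  have h1 : V (shiftn n.+1 d) b <= 1.
    by apply: (V_le_one b1 db) => k; rewrite shift_shift.
  have [k nk ek] : exists2 k, (n.+1 <= k)%N & e k = true.
    apply: contrapT => h; apply: ez; exists n.+1 => i ni.
    by case ei : (e i) => //; case: h; exists i.
  have := @V_gt0 (shiftn n.+1 e) b (k - n.+1) b1; rewrite {1}/shiftn subnKC // => /(_ ek) h2.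
  move/esym/eqP; rewrite mulf_eq0 invr_eq0 expf_eq0 /= => /orP[/eqP|/eqP]; lra.
rewrite /quasi_greedy /largest.
set P := (X in xget _ X).
have Pd : P d by [].
have [_ Pmax] : P (xget point P) by apply: xgetPex; exists d.
have [[h1 h2] _] : P (xget point P) by apply: xgetPex; exists d.
by apply: lexle_anti; [apply: dtop | apply: Pmax].
Qed.

(** * Orbits of the beta-transformation *)

Notation T := (@Tbeta R).

Lemma T_itv b x : 0 <= T b x < 1.
Proof.
rewrite /Tbeta; have /andP[] := floor_itv (b * x); rewrite intrD => h1 h2.
by apply/andP; lra.
Qed.

Lemma T_V d b : 1 < b -> V (shiftn 1 d) b < 1 -> T b (V d b) = V (shiftn 1 d) b.
Proof.
move=> b1 h; have h0 := V_ge0 (shiftn 1 d) b1.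
rewrite /Tbeta; have -> : b * V d b = (d 0%N)%:R + V (shiftn 1 d) b.
  by rewrite (V_step d b1) mulrC divfK //; lra.
rewrite (@floor_def _ _ (d 0%N)%:R).
  by case: (d 0%N); rewrite /=; lra.
by case: (d 0%N); rewrite /= ?intrD; apply/andP; split; lra.
Qed.

Lemma iter_T_V d b n : 1 < b -> (forall k, V (shiftn k d) b < 1) ->
  iter n (T b) (V d b) = V (shiftn n d) b.
Proof.
move=> b1 h; elim: n => [//|n IH].
by rewrite iterS IH T_V // shift_shift addn1.
Qed.

Definition itinerary b y : nat -> bool :=
  fun k => Num.floor (b * iter k (T b) y) == 1.

Lemma V_itinerary b y : 1 < b <= 2 -> 0 <= y < 1 -> V (itinerary b y) b = y.
Proof.
move=> /andP[b1 b2] y01.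
pose z k := iter k (T b) y.
have z01 k : 0 <= z k < 1 by case: k => [//|k]; exact: T_itv.
have zS k : z k = ((itinerary b y k)%:R + z k.+1) / b.
  have : (itinerary b y k)%:R = (Num.floor (b * z k))%:~R :> R.
    rewrite /itinerary -/(z k).
    have /andP[z0 z1] := z01 k.
    have f0 : 0 <= Num.floor (b * z k) by rewrite floor_ge0 mulr_ge0 //; lra.
    have f2 : Num.floor (b * z k) < 2.
      rewrite -(ltr_int R); apply: (le_lt_trans (floor_le_tmp _)).
      by nra.
    by case: eqP => [->//|f1]; rewrite (_ : Num.floor _ = 0) //; lia.
  move=> ->; rewrite /z iterS /Tbeta -/(z k) addrC subrK mulrC mulKf //; lra.
have C n k : `|z k - V (shiftn k (itinerary b y)) b| <= (1 + (b - 1)^-1) / b ^+ n.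
  elim: n k => [|n IH] k.
    rewrite expr0 divr1 ler_norml; have /andP[z0 z1] := z01 k.
    have := V_ge0 (shiftn k (itinerary b y)) b1.
    have : V (shiftn k (itinerary b y)) b <= (b - 1)^-1.
      by apply: V_le => // n; apply: pval_le.
    by move=> h1 h2; apply/andP; split; lra.
  rewrite zS (V_step (shiftn k _) b1) {1}/shiftn addn0 -mulrBl.
  rewrite shift_shift addn1 opprD addrACA subrr add0r normrM [X in _ * X]ger0_norm ?invr_ge0; try lra.
  rewrite exprSr invfM mulrA ler_pM2r ?invr_gt0; try lra.
  exact: IH.
apply/esym/eqP; rewrite -subr_eq0 -normr_le0; apply: (@le_geometric _ _ (1 + (b - 1)^-1) b) => // n.
by rewrite add0r; apply: (C n 0%N).
Qed.

Lemma shift_itinerary b y k : shiftn k (itinerary b y) = itinerary b (iter k (T b) y).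
Proof. by apply/funext => i; rewrite /shiftn /itinerary addnC iterD. Qed.

End Value.

(** * Admissible chains *)

Section Chain.
Local Open Scope nat_scope.

Lemma chain_gcd0 m ks : chain_gcd m ks 0 = m.
Proof. by rewrite /chain_gcd take0. Qed.

Lemma chain_gcdS m ks i : i < size ks ->
  chain_gcd m ks i.+1 = gcdn (chain_gcd m ks i) (nth 0 ks i).
Proof. by move=> ik; rewrite /chain_gcd (take_nth 0) // foldl_rcons. Qed.

Definition ratios m ks : seq rat :=
  mkseq (fun i => ((nth 0 ks i)%:R / (chain_gcd m ks i)%:R)%R) (size ks).

Lemma proper_frac k l : 0 < k < l -> proper (k%:R / l%:R)%R.
Proof.
move=> /andP[k0 kl]; have l0 : (0 < l%:R :> rat)%R by rewrite ltr0n; lia.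
apply/andP; split; first by rewrite divr_gt0 // ltr0n.
by rewrite ltr_pdivrMr // mul1r ltr_nat.
Qed.

Lemma ratios_proper m ks : admissible m ks -> all proper (ratios m ks).
Proof.
case=> _ adm _; apply/allP => _ /mapP[i + ->].
by rewrite mem_iota add0n => /adm/proper_frac.
Qed.

Lemma ratios_neq0 m ks : admissible m ks -> ratios m ks != [::].
Proof.
case=> m2 _ g1; rewrite -size_eq0 size_mkseq; apply/negP => /eqP s0.
by move: g1; rewrite s0 chain_gcd0 => m1; rewrite m1 in m2.
Qed.

Lemma ratE r : proper r -> r = ((numn r)%:R / (denn r)%:R)%R.
Proof.
case/andP=> r0 r1; rewrite -{1}(divq_num_den r) /numn /denn !natr_absz.
by rewrite !ger0_norm ?denq_ge0 ?numq_ge0 ?ltW.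
Qed.

Definition chain_of (rs : seq rat) : seq nat :=
  mkseq (fun i => numn (nth 0%R rs i) * \prod_(r <- drop i.+1 rs) denn r) (size rs).

(** With r_i = p_i/q_i, gcd(q_i Q, p_i Q) = Q for the product Q of the later
denominators, so the successive gcds are the tail products. *)
Lemma chain_of_gcd rs i : all proper rs -> i <= size rs ->
  chain_gcd (plen rs) (chain_of rs) i = plen (drop i rs).
Proof.
move=> prs; elim: i => [|i IH] ir; first by rewrite chain_gcd0 drop0.
rewrite chain_gcdS ?size_mkseq // IH; last exact: ltnW.
rewrite nth_mkseq // (drop_nth 0%R ir) plen_cons -/(plen _) -muln_gcdl gcdnC.
have /numn_denn[_ _ /eqP ->] : proper (nth 0%R rs i) by apply: (allP prs); apply: mem_nth.
by rewrite mul1n.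
Qed.

Lemma ratios_chain_of rs : all proper rs -> ratios (plen rs) (chain_of rs) = rs.
Proof.
move=> prs; apply: (@eq_from_nth _ 0%R); rewrite !size_mkseq // => i ir.
rewrite nth_mkseq ?size_mkseq // chain_of_gcd //; last exact: ltnW.
rewrite nth_mkseq // (drop_nth 0%R ir) plen_cons -/(plen _) !natrM.
have pr : proper (nth 0%R rs i) by apply: (allP prs); apply: mem_nth.
have d0 : ((plen (drop i.+1 rs))%:R != 0 :> rat)%R.
  have : all proper (drop i.+1 rs) by apply/allP => r /mem_drop /(allP prs).
  by move/plen_gt0; rewrite pnatr_eq0 lt0n.
by rewrite -mulf_div divff // mulr1 -ratE.
Qed.

Lemma chain_of_admissible rs : all proper rs -> rs != [::] ->
  admissible (plen rs) (chain_of rs).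
Proof.
move=> prs rs0; split.
- case: rs prs rs0 => //= r rs /andP[/numn_denn[p0 pq _] /plen_gt0 h] _.
  by rewrite plen_cons; nia.
- move=> i; rewrite size_mkseq => ir; rewrite chain_of_gcd //; last exact: ltnW.
  rewrite nth_mkseq // (drop_nth 0%R ir) plen_cons -/(plen _).
  have /numn_denn[p0 pq _] : proper (nth 0%R rs i) by apply: (allP prs); apply: mem_nth.
  have : 0 < plen (drop i.+1 rs).
    by apply: plen_gt0; apply/allP => r /mem_drop /(allP prs).
  by move=> h; rewrite muln_gt0 p0 h ltn_pmul2r.
- by rewrite size_mkseq chain_of_gcd // drop_size /plen big_nil.
Qed.

Lemma chain_ltP ks ls : chain_lt ks ls ->
  (size ks < size ls /\ take (size ks) ls = ks) \/
  exists j, [/\ j < size ks, j < size ls, take j ks = take j ls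
             & nth 0 ks j < nth 0 ls j].
Proof.
elim: ks ls => [|k ks IH] [|l ls] //=; first by left.
rewrite /chain_lt Order.SeqLexiOrder.Exports.ltxi_cons leEnat.
case/andP=> kl /implyP h; have [lk|lk] := leqP l k.
  have -> : k = l by lia.
  case: (IH ls (h lk)) => [[s1 s2]|[j [j1 j2 j3 j4]]]; [left|right].
    by rewrite s2.
  by exists j.+1; split=> //=; rewrite j3.
by right; exists 0.
Qed.

(** Of two admissible chains neither is a proper prefix of the other, since the
gcd of a complete chain is 1 and leaves no room for a further entry. *)
Lemma admissible_ltP m ks ls : admissible m ks -> admissible m ls -> chain_lt ks ls ->
  exists j, [/\ j < size ks, j < size ls, take j ks = take j ls
             & nth 0 ks j < nth 0 ls j].
Proof.
move=> [_ _ k1] [_ ladm _] /chain_ltP[[s1 s2]|//].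
have := ladm _ s1; move: k1; rewrite /chain_gcd s2 take_size => ->; lia.
Qed.

Lemma ratios_lt m ks ls : admissible m ks -> admissible m ls -> chain_lt ks ls ->
  exists j, [/\ j < size ks, j < size ls,
    forall i, i < j -> nth 0%R (ratios m ls) i = nth 0%R (ratios m ks) i
    & (nth 0%R (ratios m ks) j < nth 0%R (ratios m ls) j)%R].
Proof.
move=> aks als lt; have [j [jk jl tj nj]] := admissible_ltP aks als lt.
have tE i : i <= j -> chain_gcd m ks i = chain_gcd m ls i.
  by move=> ij; rewrite /chain_gcd -(take_takel ks ij) tj take_takel.
exists j; split=> // [i ij|].
  rewrite !nth_mkseq ?(ltn_trans ij) // tE ?(ltnW ij) //.
  by rewrite -(nth_take 0 ij ks) tj nth_take.
rewrite !nth_mkseq // -tE // ltr_pM2r ?ltr_nat // invr_gt0 ltr0n.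
by case: aks => _ /(_ _ jk) h _; lia.
Qed.

Lemma admissible_bound m ks : admissible m ks ->
  size ks <= m /\ forall k, k \in ks -> k < m.
Proof.
case=> m2 adm _.
have G i : i <= size ks -> chain_gcd m ks i + i <= m.
  elim: i => [|i IH] ik; first by rewrite chain_gcd0 addn0.
  have := IH (ltnW ik); have /andP[n0 ng] := adm _ ik.
  have := dvdn_leq n0 (dvdn_gcdr (chain_gcd m ks i) (nth 0 ks i)).
  by rewrite chain_gcdS //; lia.
split; first by have := G _ (leqnn _); lia.
move=> k /(nthP 0)[i ik <-]; have /andP[_ h] := adm _ ik.
by apply: (leq_trans h); have := G _ (ltnW ik); lia.
Qed.

Lemma top_admissible m : 2 <= m -> admissible m [:: m.-1].
Proof.
move=> m2; have g : gcdn m m.-1 = 1.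
  by apply/eqP; rewrite -{1}(prednK (ltnW m2)) -/(coprime _ _) coprimeSn.
by split=> // -[|i] //= _; rewrite chain_gcd0; lia.
Qed.

Lemma lt_top m ks : admissible m ks -> ks != [:: m.-1] -> chain_lt ks [:: m.-1].
Proof.
case=> m2 adm; case: ks adm => [|k ks] adm; first by rewrite chain_gcd0; lia.
move=> g1 ne; have := adm 0 isT; rewrite chain_gcd0 /= => kb.
rewrite /chain_lt Order.SeqLexiOrder.Exports.ltxi_cons leEnat.
rewrite (_ : k <= m.-1) /=; last by lia.
apply/implyP => mk; have ek : k = m.-1 by lia.
case: ks adm g1 ne => [|k2 ks] adm g1 ne; first by rewrite ek eqxx in ne.
have := adm 1 isT; rewrite chain_gcdS // chain_gcd0 /= ek.
have -> : gcdn m m.-1 = 1.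
  by have [_ _] := top_admissible m2; rewrite chain_gcdS // chain_gcd0.
lia.
Qed.

(** Admissible chains for m have at most m entries, all less than m, so they are
encoded in a finite type, and the chains above ks have a minimum. *)
Lemma exists_succ m ks : admissible m ks -> ks != [:: m.-1] ->
  exists ks', immediate_succ m ks ks'.
Proof.
move=> aks ne; have m2 : 2 <= m by case: aks.
pose T := m.-bseq 'I_m.
pose F (t : T) : seqlexi nat := map (@nat_of_ord m) t.
have enc ls : admissible m ls -> exists t : T, F t = ls.
  move=> als; have [sl bl] := admissible_bound als.
  have sm : size (pmap insub ls : seq 'I_m) <= m.
    by rewrite size_pmap (leq_trans (count_size _ _)).
  exists (Bseq sm); rewrite /F /=.
  elim: (ls) bl => //= l ls' IH bl.
  rewrite insubT ?bl ?mem_head // => lm /=; rewrite IH // => k kl.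
  by apply: bl; rewrite in_cons kl orbT.
pose P (t : T) := `[< admissible m (F t) /\ chain_lt ks (F t) >].
have [t0 t0E] := enc _ (top_admissible m2).
have Pt0 : P t0.
  by apply/asboolP; rewrite t0E; split; [apply: top_admissible | apply: lt_top].
case: (arg_minP F Pt0) => t /asboolP[at1 lt1] tmin.
exists (F t); split=> // ls als [l1 l2].
have [u uE] := enc _ als; have := tmin u; rewrite uE.
move=> h; have {}h : (F t <= ls :> seqlexi nat)%O.
  by apply: h; apply/asboolP; rewrite uE.
by move: l2; rewrite /chain_lt lt_leAnge h andbF.
Qed.

End Chain.

(** * The base determined by a sequence of slopes *)

Section Main.
Variable R : realType.
Local Open Scope classical_set_scope.
Local Open Scope ring_scope.
Notation V := (@expansion_value R).

Lemma beta_chainP m ks : admissible m ks ->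
  1 < beta_chain R m ks < 2 /\ V (high (ratios m ks)) (beta_chain R m ks) = 1.
Proof.
move=> adm; have prs := ratios_proper adm; have rs0 := ratios_neq0 adm.
rewrite /beta_chain /largest; set P := (X in xget _ X).
have chw : winfty (Lmax (chain_word m ks)) = high (ratios m ks) by apply: winfty_high.
have [b b12 bV] := @exists_base R (high (ratios m ks)) (fun c N => high_infinitely c N prs rs0).
suff [[h1 h2] _] : P (xget point P) by split=> //; rewrite -chw.
apply: xgetPex; exists b; split; first by split => //; rewrite chw.
move=> c [/andP[c1 _]]; rewrite chw => cV.
rewrite (base_unique _ _ cV bV) //; by case/andP: b12.
Qed.

Lemma cvg_cantor (u : nat -> cantor_space) (x : cantor_space) :
  (forall k n, (k < n)%N -> u n k = x k) -> u @ \oo --> x.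
Proof.
move=> h; apply/cvg_sup => k U [/= W [[B oB <-] Bx]] WU.
suff : \forall n \near \oo, U (u n) by [].
near=> n; apply: WU; change (B (u n k)); rewrite h //; near: n; exact: nbhs_infty_gt.
Unshelve. all: by end_near. Qed.

Section Limit.
Variable r : nat -> rat.
Hypothesis pr : forall i, proper (r i).

Lemma I_rat_delta n b : (0 < n)%N -> 1 < b < 2 -> V (delta r) b = 1 ->
  I_rat R (mkseq r n) b.
Proof.
move=> n0 /andP[b1 b2] db; set rs := mkseq r n.
have prs : all proper rs by apply: proper_mkseq.
have rs0 : rs != [::] by rewrite -size_eq0 size_mkseq -lt0n.
have adm := chain_of_admissible prs rs0.
have dinf c N := delta_infinitely c N pr.
have -> : I_rat R rs = I_chain R (plen rs) (chain_of rs) by [].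
split.
  have [/andP[c1 _] cV] := beta_chainP adm; rewrite ratios_chain_of // in cV.
  apply: (base_lt c1 b1 cV db) => //; first exact: high_max.
  exact: high_lt_delta.
case: eqP => [_|/eqP top]; first by rewrite /= ltW.
have [ks' succ] := exists_succ adm top; exists ks' => //.
have [adm' lt _] := succ; have [/andP[c1 _] cV] := beta_chainP adm'.
have prs' := ratios_proper adm'; have rs0' := ratios_neq0 adm'.
apply/ltW/(base_lt b1 c1 db cV) => //.
- by move=> N; apply: high_infinitely.
- exact: delta_max.
have [j [jk jl eqj ltj]] := ratios_lt adm adm' lt.
rewrite ratios_chain_of // in eqj ltj; rewrite size_mkseq size_mkseq in jk.
apply: (@delta_lt_high _ _ j) => //; first by rewrite size_mkseq.
- by move=> i ij; rewrite eqj // nth_mkseq // (ltn_trans ij).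
- by move: ltj; rewrite nth_mkseq.
Qed.

Lemma high_cvg_delta :
  (fun n => winfty (Lmax (farey_bullets (mkseq r n.+1)))) @ \oo --> (delta r : cantor_space).
Proof.
apply: cvg_cantor => k n kn; rewrite winfty_high ?proper_mkseq //.
by rewrite -delta_high // ltnW.
Qed.

(** The orbit of the value of [low] realises the threshold t equal to that value.
Conversely an orbit of smallest period m avoiding (0, t) has an itinerary with
shifts below [delta]; by [low_extremal] some shift is at most [low], and the
corresponding orbit point is nonzero, hence at least t. *)
Lemma tau_delta n b : (0 < n)%N -> 1 < b < 2 -> V (delta r) b = 1 ->
  tau (plen (mkseq r n)) b = V (low (mkseq r n)) b.
Proof.
move=> n0 /andP[b1 b2] db; set rs := mkseq r n.
have prs : all proper rs by apply: proper_mkseq.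
have rs0 : rs != [::] by rewrite -size_eq0 size_mkseq -lt0n.
have dinf c N := delta_infinitely c N pr.
have lowlt k : lexlt (shiftn k (low rs)) (delta r).
  by apply: lexle_lt_trans (high_lt_delta n pr); apply: low_le_high.
have low1 k : V (shiftn k (low rs)) b < 1.
  apply: (V_lt_one b1 db) => // j; rewrite shift_shift; exact/lexltW.
have [lper _] := farey_substs_period false prs.
have lmin k : V (low rs) b <= V (shiftn k (low rs)) b.
  by apply: V_le_of_lexle => //; apply: low_min.
have itE k : iter k (Tbeta b) (V (low rs) b) = V (shiftn k (low rs)) b by apply: iter_T_V.
set x := V (low rs) b in lmin itE *.
have x01 : 0 <= x < 1 by rewrite V_ge0 //=; apply: (low1 0%N).
rewrite /tau; set A := (X in sup X).
have Ax : A x.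
  split=> //; exists x; split.
    split; first exact: plen_gt0.
      by rewrite itE lper.
    move=> k kn; rewrite itE /x => e.
    have ne := low_primitive prs kn.
    have [lt|[//|lt]] := lexltP (shiftn k (low rs)) (low rs).
      have : V (shiftn k (low rs)) b < V (low rs) b.
        by apply: V_lt => // j; rewrite shift_shift.
      by rewrite e ltxx.
    have : V (low rs) b < V (shiftn k (low rs)) b by apply: V_lt.
    by rewrite e ltxx.
  move=> k; split; first by rewrite itE V_ge0 //=.
  move=> j; rewrite -iterD itE => /andP[_]; rewrite ltNge => /negP; apply; exact: lmin.
have Aub : ubound A x.
  move=> t [/andP[t0 t1] [y [[m0 yper ymin] ysur]]].
  have y01 : 0 <= y < 1 by case: (ysur 0%N).
  have b12 : 1 < b <= 2 by rewrite b1 ltW.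
  pose e := itinerary b y.
  have eV k : V (shiftn k e) b = iter k (Tbeta b) y.
    rewrite shift_itinerary V_itinerary //.
    by case: (ysur k).
  have elt1 k : V (shiftn k e) b < 1.
    by rewrite eV; case: (ysur k) => /andP[].
  have eper : shiftn (plen rs) e = e by rewrite shift_itinerary yper.
  have emin k : (0 < k < plen rs)%N -> shiftn k e <> e.
    by move=> kn ke; apply: (ymin k kn); rewrite -eV ke -[RHS](eV 0%N).
  have elt k : lexlt (shiftn k e) (farey_substs rs true (delta (fun i => r (n + i)%N))).
    rewrite -delta_subs //.
    exact: (lexlt_of_V_lt_one b1 db (delta_max pr)).
  have [k le] := low_extremal prs eper emin elt.
  have kx : iter k (Tbeta b) y <= x.
    rewrite -eV /x; apply: V_le_of_lexle => // j; by rewrite shift_shift.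
  have [zk01 zk] := ysur k; apply: le_trans kx; rewrite leNgt; apply/negP => lt.
  apply: (zk 0%N); rewrite /= lt andbT lt_neqAle; case/andP: zk01 => -> _.
  rewrite andbT eq_sym; apply/eqP => z0.
  have [pl2 _ _] := chain_of_admissible prs rs0.
  (* An orbit through 0 would have the zero itinerary, which has period 1. *)
  have ef i : e i = false.
    rewrite -(shift_period k eper); case ei : (shiftn _ _ _) => //.
    have kk : (k <= k * plen rs + i)%N by rewrite -{1}[k]muln1 -[(k * 1)%N]addn0 leq_add // leq_mul2l m0 orbT.
    have := @V_gt0 R (shiftn k e) b (k * plen rs + i - k)%N b1.
    rewrite {1}/shiftn subnKC // => /(_ ei); rewrite eV z0 ltxx //.
  by apply: (emin 1%N); [apply/andP; split | apply/funext => i; rewrite /shiftn !ef].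
apply/eqP; rewrite eq_le; apply/andP; split.
  by apply: ge_sup => //; exists x.
by apply: ub_le_sup => //; exists x.
Qed.

End Limit.
End Main.

Local Open Scope classical_set_scope.
Local Open Scope ring_scope.

Lemma coprime_denn (p q : nat) : coprime p q -> proper (p%:R / q%:R) ->
  denn (p%:R / q%:R) = q.
Proof.
move=> pq /andP[r0 _].
have q0 : (0 < q)%N.
  by rewrite lt0n; apply/eqP => q0; rewrite q0 invr0 mulr0 ltxx in r0.
have := @coprimeq_den p%:Z q%:Z pq.
rewrite /denn => ->; case: eqP => [q0'|_]; last by [].
by rewrite (_ : q = 0%N) // in q0; lia.
Qed.

Unset Implicit Arguments.

Theorem proposition6p4 (R : realType) (r : nat -> rat)
    (hr : forall i, 0 < r i < 1) :
  exists beta : R,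
    unique (fun b : R =>
      (\bigcap_(n in [set n | (0 < n)%N]) I_rat R (mkseq r n)) b /\
      (fun n => winfty (Lmax (farey_bullets (mkseq r n.+1)))) @ \oo
        --> quasi_greedy b) beta /\
    forall p q : nat -> nat,
      (forall i, coprime (p i) (q i)) ->
      (forall i, r i = (p i)%:R / (q i)%:R) ->
      forall n, (0 < n)%N ->
        tau (\prod_(i < n) q i)%N beta =
        expansion_value (winfty (farey_bullets (mkseq r n))) beta.
Proof.
have pr : forall i, proper (r i) by [].
have [b b12 db] := @exists_base R (delta r) (fun c N => delta_infinitely c N pr).
have b1 : 1 < b by case/andP: b12.
have dinf c N := delta_infinitely c N pr.
have cvgd := high_cvg_delta pr.
exists b; split; first split.
- split; first by move=> n n0; apply: I_rat_delta.
  by rewrite (quasi_greedyE b1 db (delta_max pr)).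
- move=> c [cI ccvg].
  have c1 : 1 < c.
    have [+ _] : I_rat R (mkseq r 1) c by apply: cI.
    have adm : admissible (plen (mkseq r 1)) (chain_of (mkseq r 1)).
      by apply: chain_of_admissible => //; apply: proper_mkseq.
    have [/andP[h _] _] := beta_chainP R adm; exact: lt_trans.
  have qd : quasi_greedy c = delta r.
    exact: (cvg_unique cantor_space_hausdorff ccvg cvgd).
  apply: (base_unique b1 c1 db).
  move: qd; rewrite /quasi_greedy /largest; case: xgetP => [_ -> [[+ _] _] <- //|_].
  by move=> /(congr1 (fun x : cantor_space => x 0%N)); rewrite delta0.
- move=> p q cpq rE n n0.
  have rs0 : mkseq r n != [::] by rewrite -size_eq0 size_mkseq -lt0n.
  rewrite winfty_low ?proper_mkseq // -tau_delta //; congr tau.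
  rewrite /plen big_map -val_enum_ord big_map big_enum /=; apply: eq_bigr => i _.
  by rewrite rE coprime_denn // -rE.
Qed.
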